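(* Let $\Sigma$ be a complete smooth fan in $N_{\mathbb{R}}$ (with respect to the lattice $N = \mathbb{Z}^n/\mathbb{Z}e_{[n]}$) that is refined by the braid arrangement fan $\mathcal{B}(n)$. Then there exists a finite sequence of fans $(\Sigma_0, \Sigma_1, \dots, \Sigma_\ell)$ such that $\Sigma_0 = \Sigma$, $\Sigma_\ell = \mathcal{B}(n)$, and for each $1 \leq i \leq \ell$ the fan $\Sigma_i$ is obtained from $\Sigma_{i-1}$ by a (smooth) star subdivision.
   Context: Notation. Let $[n] = \{1,\dots,n\}$, let $e_1,\dots,e_n$ be the standard basis of $\mathbb{Z}^n$, and for $A \subseteq [n]$ let $e_A = \sum_{i\in A} e_i$. Let $N = \mathbb{Z}^n/\mathbb{Z}e_{[n]}$ and $N_{\mathbb{R}} = \mathbb{R}\otimes_{\mathbb{Z}} N = \mathbb{R}^n/\mathbb{R}e_{[n]}$. For $1\le i<j\le n$ let $H_{ij}\subseteq N_{\mathbb{R}}$ be the hyperplane $x_i = x_j$ (well defined on the quotient). The braid arrangement is $\{H_{ij}\}_{1\le i<j\le n}$, and the braid arrangement fan $\mathcal{B}(n)$ is the complete fan in $N_{\mathbb{R}}$ it determines: its maximal cones are the closures of the connected components of the complement of the arrangement, i.e. the cones $\{x_{w(1)}\le x_{w(2)}\le\cdots\le x_{w(n)}\}$ for permutations $w$ of $[n]$ (the type $A_{n-1}$ Weyl chambers), and its cones are all faces of these. Fans. A fan is a finite collection of strongly convex rational polyhedral cones in $N_{\mathbb{R}}$, closed under taking faces, such that any two cones meet in a common face;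 it is complete if the union of its cones is $N_{\mathbb{R}}$. A complete fan $\Sigma$ is refined by $\mathcal{B}(n)$ if every cone of $\mathcal{B}(n)$ is contained in some cone of $\Sigma$ (equivalently, every cone of $\Sigma$ is a union of cones of $\mathcal{B}(n)$). For a cone $\sigma$, let $\sigma(1)$ be the set of minimal (primitive) lattice points of $N$ on the rays of $\sigma$. For a finite set $A\subseteq N$, $\mathrm{cone}(A) = \{\sum_{v\in A}\lambda_v v : \lambda_v\in\mathbb{R},\ \lambda_v\ge 0\}$. A cone $\sigma$ is smooth if $\sigma(1)$ can be extended to a $\mathbb{Z}$-basis of $N$; a fan is smooth if all its cones are. Star subdivision. Let $\Sigma$ be a smooth fan, $\tau\in\Sigma$ a nonzero cone, $\tau(1) = \{v_1,\dots,v_k\}$, and $v_0 = v_1+\cdots+v_k$. For $\sigma\in\Sigma$ with $\tau\subseteq\sigma$ put $$\Sigma^*_\sigma(\tau) = \{\mathrm{cone}(A) : A\subseteq\sigma(1)\cup\{v_0\},\ \tau(1)\not\subseteq A\}.$$ The (smooth) star subdivision of $\Sigma$ relative to $\tau$ is $$\Sigma^*(\tau) = \{\sigma\in\Sigma : \tau\not\subseteq\sigma\}\cup\bigcup_{\sigma\in\Sigma,\ \tau\subseteq\sigma}\Sigma^*_\sigma(\tau).$$ A fan is obtained from $\Sigma$ by a star subdivision if it equals $\Sigma^*(\tau)$ for some such $\tau$. The sequence may have $\ell = 0$. *)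

(* Defs.v *)
From HB Require Import structures.
From mathcomp Require Import all_boot all_order all_algebra generic_quotient perm.
From mathcomp Require Import boolp classical_sets functions cardinality fsbigop.
From mathcomp Require Import reals.

Set Implicit Arguments.
Unset Strict Implicit.
Unset Printing Implicit Defensive.

Import Order.TTheory GRing.Theory Num.Theory.
Local Open Scope classical_set_scope.
Local Open Scope ring_scope.
Local Open Scope quotient_scope.

(* The quotient K^n / K e_[n] of the free K-module of row vectors by the line
   spanned by e_[n] = (1, ..., 1); it is used for K = int and for K = R. *)
Section Quotient.
Variables (K : comNzRingType) (n : nat).
Implicit Types x y z : 'rV[K]_n.

Definition ones_equiv x y : bool := `[< exists a : K, x - y = a *: const_mx 1 >].

Fact ones_equiv_refl : reflexive ones_equiv.
Proof. by move=> x; apply/asboolP; exists 0; rewrite subrr scale0r. Qed.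

Fact ones_equiv_sym : symmetric ones_equiv.
Proof.
suff sub x y : ones_equiv x y -> ones_equiv y x.
  by move=> x y; apply/idP/idP; apply: sub.
by move=> /asboolP[a Ha]; apply/asboolP; exists (- a); rewrite scaleNr -Ha opprB.
Qed.

Fact ones_equiv_trans : transitive ones_equiv.
Proof.
move=> y x z /asboolP[a Ha] /asboolP[b Hb]; apply/asboolP; exists (a + b).
by rewrite scalerDl -Ha -Hb addrA subrK.
Qed.

Canonical ones_equiv_rel :=
  EquivRel ones_equiv ones_equiv_refl ones_equiv_sym ones_equiv_trans.

Definition quot_ones := {eq_quot ones_equiv_rel}.
HB.instance Definition _ := Choice.on quot_ones.
HB.instance Definition _ := EqQuotient.on quot_ones.

Lemma quot_onesP x y :
  reflect (exists a : K, x - y = a *: const_mx 1) (x == y %[mod quot_ones]).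
Proof. by rewrite piE; apply: asboolP. Qed.

Definition quot_zero : quot_ones := lift_cst quot_ones 0.
Definition quot_opp := lift_op1 quot_ones (@GRing.opp 'rV[K]_n).
Definition quot_add := lift_op2 quot_ones (@GRing.add 'rV[K]_n).
Definition quot_scale (a : K) := lift_op1 quot_ones (fun x => a *: x).

Fact pi_quot_zero : \pi_quot_ones 0 = quot_zero.
Proof. by rewrite /quot_zero -lock. Qed.

Fact pi_quot_opp : {morph \pi_quot_ones : x / - x >-> quot_opp x}.
Proof.
move=> x; unlock quot_opp; apply/eqP/quot_onesP.
have /eqP/quot_onesP[a Ha] : x = repr (\pi_quot_ones x) %[mod quot_ones].
  by rewrite reprK.
by exists (- a); rewrite scaleNr -Ha opprB opprK addrC.
Qed.

Fact pi_quot_add : {morph \pi_quot_ones : x y / x + y >-> quot_add x y}.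
Proof.
move=> x y; unlock quot_add; apply/eqP/quot_onesP.
have /eqP/quot_onesP[a Ha] : x = repr (\pi_quot_ones x) %[mod quot_ones].
  by rewrite reprK.
have /eqP/quot_onesP[b Hb] : y = repr (\pi_quot_ones y) %[mod quot_ones].
  by rewrite reprK.
by exists (a + b); rewrite scalerDl -Ha -Hb opprD addrACA.
Qed.

Fact pi_quot_scale (a : K) :
  {morph \pi_quot_ones : x / a *: x >-> quot_scale a x}.
Proof.
move=> x; unlock quot_scale; apply/eqP/quot_onesP.
have /eqP/quot_onesP[b Hb] : x = repr (\pi_quot_ones x) %[mod quot_ones].
  by rewrite reprK.
by exists (a * b); rewrite -scalerA -Hb scalerBr.
Qed.

Canonical pi_quot_zero_morph := PiMorph pi_quot_zero.
Canonical pi_quot_opp_morph := PiMorph1 pi_quot_opp.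
Canonical pi_quot_add_morph := PiMorph2 pi_quot_add.
Canonical pi_quot_scale_morph a := PiMorph1 (pi_quot_scale a).

Fact quot_addA : associative quot_add.
Proof. by elim/quotW=> x; elim/quotW=> y; elim/quotW=> z; rewrite !piE addrA. Qed.

Fact quot_addC : commutative quot_add.
Proof. by elim/quotW=> x; elim/quotW=> y; rewrite !piE addrC. Qed.

Fact quot_add0 : left_id quot_zero quot_add.
Proof. by elim/quotW=> x; rewrite !piE add0r. Qed.

Fact quot_addN : left_inverse quot_zero quot_opp quot_add.
Proof. by elim/quotW=> x; rewrite !piE addNr. Qed.

HB.instance Definition _ :=
  GRing.isZmodule.Build quot_ones quot_addA quot_addC quot_add0 quot_addN.

Fact quot_scaleA a b v : quot_scale a (quot_scale b v) = quot_scale (a * b) v.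
Proof. by elim/quotW: v => x; rewrite !piE scalerA. Qed.

Fact quot_scale1 : left_id 1 quot_scale.
Proof. by elim/quotW=> x; rewrite !piE scale1r. Qed.

Fact quot_scaleDr : right_distributive quot_scale +%R.
Proof.
move=> a; elim/quotW=> x; elim/quotW=> y.
by rewrite -[LHS]/(quot_scale a (quot_add _ _)) -[RHS]/(quot_add _ _) !piE scalerDr.
Qed.

Fact quot_scaleDl v : {morph quot_scale^~ v : a b / a + b}.
Proof.
move=> a b; elim/quotW: v => x.
by rewrite -[RHS]/(quot_add _ _) !piE scalerDl.
Qed.

HB.instance Definition _ := GRing.Zmodule_isLmodule.Build K quot_ones
  quot_scaleA quot_scale1 quot_scaleDr quot_scaleDl.

Lemma pi_onesD x y : \pi_quot_ones (x + y) = \pi_quot_ones x + \pi_quot_ones y.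
Proof. exact: pi_quot_add. Qed.

Lemma pi_onesZ a x : \pi_quot_ones (a *: x) = a *: \pi_quot_ones x.
Proof. exact: pi_quot_scale. Qed.

End Quotient.

Notation spaceN R n := (quot_ones R n).
Notation latN n := (quot_ones int n).

Definition is_Zbasis (n : nat) (b : seq (latN n)) : Prop :=
  forall v : latN n, exists! c : {ffun 'I_(size b) -> int},
    v = \sum_(i < size b) c i *: b`_i.

Section Fans.
Variables (R : realType) (n : nat).
Implicit Types (sigma tau rho : set (spaceN R n)).
Implicit Types (Sigma : set (set (spaceN R n))) (A : set (latN n)).

(* The canonical injection of N into N_R; see toNR_pi for independence of the
   representative. *)
Definition toNR (v : latN n) : spaceN R n :=
  \pi_(spaceN R n) (map_mx intr (repr v)).

Lemma toNR_pi (z : 'rV[int]_n) :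
  toNR (\pi_(latN n) z) = \pi_(spaceN R n) (map_mx intr z).
Proof.
rewrite /toNR; apply/eqP/quot_onesP.
have /eqP/quot_onesP[a Ha] :
    repr (\pi_(latN n) z) = z %[mod latN n] by rewrite reprK.
by exists a%:~R; rewrite -map_mxB Ha map_mxZ map_const_mx rmorph1.
Qed.

(* Only meaningful for finite A, as \sum_(v \in A) is a finitely supported sum. *)
Definition cone A : set (spaceN R n) :=
  [set x | exists2 lam : latN n -> R,
     (forall v, A v -> 0 <= lam v) & x = \sum_(v \in A) (lam v *: toNR v)].

Definition rational_polyhedral_cone sigma : Prop :=
  exists2 A, finite_set A & sigma = cone A.

Definition strongly_convex sigma : Prop :=
  forall x, sigma x -> sigma (- x) -> x = 0.

Definition is_face tau sigma : Prop :=
  exists2 u : {scalar spaceN R n},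
    (forall x, sigma x -> 0 <= u x) & tau = [set x | sigma x /\ u x = 0].

Definition is_fan Sigma : Prop :=
  [/\ finite_set Sigma,
      forall sigma, Sigma sigma ->
        rational_polyhedral_cone sigma /\ strongly_convex sigma,
      forall sigma tau, Sigma sigma -> is_face tau sigma -> Sigma tau
    & forall sigma tau, Sigma sigma -> Sigma tau ->
        is_face (sigma `&` tau) sigma /\ is_face (sigma `&` tau) tau].

Definition complete Sigma : Prop :=
  \bigcup_(sigma in Sigma) sigma = [set: spaceN R n].

Definition is_ray rho : Prop :=
  exists2 x : spaceN R n, x != 0 & rho = [set c *: x | c in [set c : R | 0 <= c]].

Definition minimal_lattice_point (v : latN n) rho : Prop :=
  [/\ v != 0, rho (toNR v)
    & forall w : latN n, w != 0 -> rho (toNR w) ->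
        exists2 c : R, 1 <= c & toNR w = c *: toNR v].

(* The set written sigma(1): minimal lattice points on the rays of sigma. *)
Definition gens sigma : set (latN n) :=
  [set v | exists rho,
     [/\ is_face rho sigma, is_ray rho & minimal_lattice_point v rho]].

Definition smooth_cone sigma : Prop :=
  exists2 b : seq (latN n), is_Zbasis b & gens sigma `<=` [set` b].

Definition smooth_fan Sigma : Prop :=
  is_fan Sigma /\ forall sigma, Sigma sigma -> smooth_cone sigma.

Definition chamber (w : 'S_n) : set (spaceN R n) :=
  [set \pi_(spaceN R n) x | x in
     [set x : 'rV[R]_n | forall i j : 'I_n, (i <= j)%N -> x 0 (w i) <= x 0 (w j)]].

Definition braid_fan : set (set (spaceN R n)) :=
  [set tau | exists w : 'S_n, is_face tau (chamber w)].

Definition refined_by Sigma Sigma' : Prop :=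
  forall tau, Sigma' tau -> exists2 sigma, Sigma sigma & tau `<=` sigma.

Definition star_cones sigma tau : set (set (spaceN R n)) :=
  let v0 := \sum_(v \in gens tau) v in
  [set cone A | A in
     [set A | A `<=` gens sigma `|` [set v0] /\ ~ (gens tau `<=` A)]].

Definition star_subdivision Sigma tau : set (set (spaceN R n)) :=
  [set sigma | Sigma sigma /\ ~ (tau `<=` sigma)] `|`
  \bigcup_(sigma in [set sigma | Sigma sigma /\ tau `<=` sigma])
     star_cones sigma tau.

Definition obtained_by_star_subdivision Sigma Sigma' : Prop :=
  smooth_fan Sigma /\
  exists tau, [/\ Sigma tau, tau <> [set 0] & Sigma' = star_subdivision Sigma tau].

End Fans.

Arguments braid_fan R n : clear implicits.

(* Main.v *)
From HB Require Import structures.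
From mathcomp Require Import all_boot all_order all_algebra all_fingroup generic_quotient.
From mathcomp Require Import boolp classical_sets functions cardinality fsbigop reals.
From mathcomp Require Import ring lra.
Require Import Defs.

Set Implicit Arguments.
Unset Strict Implicit.
Unset Printing Implicit Defensive.

Import Order.TTheory GRing.Theory Num.Theory.
Local Open Scope classical_set_scope.
Local Open Scope ring_scope.
Local Open Scope quotient_scope.

(** A cone of the braid fan is spanned by the classes [vec A] of indicator
    vectors of proper nonempty sets [A] of indices, so a smooth fan [Sigma]
    refined by the braid fan is recorded by a simplicial complex [K] on these
    sets ([fan_of_complex_of], [complex_of_braid_complex]): expanding a point
    of a cone along a chamber shows that the cone is generated by classes
    [vec A], and smoothness makes an irredundant set of generators linearly
    independent.  What is kept of [Sigma] is that nonnegative combinations over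
    faces of [K] are unique and that each chamber lies in the cone of a face
    ([braid_complex]).

    A face [S] of [K] whose cone contains a chamber behaves like a tree on the
    indices with edge set [S]: each wall of its cone lies in a hyperplane [x_a = x_b], so
    every [A] in [S] has an edge [a -> b] whose removal splits the
    indices into [A] and its complement, and [x_b - x_a] is the coordinate dual to [vec A]
    ([full_edge]).  Moreover two members of a face are nested, disjoint or cover
    all indices ([bc_laminar]).

    If any two members of a face are always nested, then every cone of the fan is
    a braid cone and the fan is the braid fan ([fan_of_chains]).  Otherwise take
    a disjoint pair [{A, B}] in [K] with the largest possible union.  In every
    tree that contains it the edges of [A] and [B] start at the same vertex: an
    edge separating their two starting vertices would allow [A] or [B] to be
    enlarged ([disjoint_grow]).  So the difference of the two dual coordinates is
    [x_b - x_b'], which has constant sign on each chamber.  The star subdivision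
    at [cone {vec A, vec B}] cuts cones where the two coordinates agree, hence
    along a braid hyperplane, and its new ray is [vec A + vec B = vec (A :|: B)];
    the new fan is therefore again refined by the braid fan
    ([star_braid_complex]).  If no pair is disjoint, complementation reduces
    a covering pair to the same argument, with new ray [vec (A :&: B)].  Each
    step adds a ray [vec C], and there are finitely many, so the process stops. *)

(** * Coordinate differences and indicator classes *)
Section CoordinateDifferences.
Variables (K : comNzRingType) (n : nat).

(** Differences of coordinates are the functionals that separate points of the
    quotient and whose kernels are the braid hyperplanes. *)
Definition dif (i j : 'I_n) (x : quot_ones K n) : K := repr x 0 i - repr x 0 j.

Lemma dif_pi i j (x : 'rV[K]_n) : dif i j (\pi x) = x 0 i - x 0 j.
Proof.
have /eqP/quot_onesP[a Ha] :
    repr (\pi_(quot_ones K n) x) = x %[mod quot_ones K n] by rewrite reprK.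
move/matrixP: Ha => Ha; rewrite /dif.
have := Ha 0 i; have := Ha 0 j; rewrite !mxE mulr1 => /eqP + /eqP.
rewrite !subr_eq => /eqP -> /eqP ->.
by rewrite opprD addrACA subrr add0r.
Qed.

Fact dif_is_linear i j : linear_for *%R (dif i j).
Proof.
move=> a; elim/quotW=> x; elim/quotW=> y.
rewrite -pi_onesZ -pi_onesD !dif_pi !mxE; ring.
Qed.

HB.instance Definition _ i j :=
  GRing.isLinear.Build K (quot_ones K n) K *%R (dif i j) (dif_is_linear i j).

Lemma dif_inj (x y : quot_ones K n) : (forall i j, dif i j x = dif i j y) -> x = y.
Proof.
elim/quotW: x => x; elim/quotW: y => y Hxy; apply/eqP/quot_onesP.
have [i0 _|n0] := pickP 'I_n; last by exists 0; apply/matrixP=> k i; have := n0 i.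
exists (x 0 i0 - y 0 i0); apply/matrixP=> k i; rewrite !mxE (ord1 k) mulr1.
by have := Hxy i i0; rewrite !dif_pi => /eqP; rewrite subr_eq => /eqP ->; ring.
Qed.

Lemma difC i j (x : quot_ones K n) : dif i j x = - dif j i x.
Proof. by rewrite /dif opprB. Qed.

(** Computed on a representative, hence meaningful when the entries of [u] add
    up to zero. *)
Definition lfun (u : 'cV[K]_n) (x : quot_ones K n) : K := (repr x *m u) 0 0.

Section Lfun.
Variables (u : 'cV[K]_n) (u0 : const_mx 1 *m u = 0 :> 'M_1).

Lemma lfun_pi (x : 'rV[K]_n) : lfun u (\pi x) = (x *m u) 0 0.
Proof.
have /eqP/quot_onesP[a Ha] :
    repr (\pi_(quot_ones K n) x) = x %[mod quot_ones K n] by rewrite reprK.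
rewrite /lfun -[LHS]subr0 -[X in _ - X](subrr ((x *m u) 0 0)) opprB addrA addrAC.
have -> : (repr (\pi_(quot_ones K n) x) *m u) 0 0 - (x *m u) 0 0
  = ((repr (\pi_(quot_ones K n) x) - x) *m u) 0 0 by rewrite mulmxBl !mxE.
by rewrite Ha -scalemxAl u0 scaler0 mxE add0r.
Qed.

Lemma lfun_scalar : exists f : {scalar quot_ones K n}, f =1 lfun u.
Proof.
have lin : linear_for *%R (lfun u).
  move=> a; elim/quotW=> x; elim/quotW=> y.
  by rewrite -pi_onesZ -pi_onesD !lfun_pi mulmxDl -scalemxAl !mxE.
pose m := GRing.isLinear.Build K (quot_ones K n) K *%R (lfun u) lin.
by exists (HB.pack_for {scalar quot_ones K n} (lfun u) m).
Qed.
End Lfun.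
End CoordinateDifferences.

Section IndicatorClasses.
Variables (R : realType) (n : nat).
Local Notation P := {set 'I_n}.
Implicit Types (A B : P) (S T : {set P}) (i j : 'I_n).

Definition lat A : latN n := \pi_(latN n) (\row_i (i \in A)%:R).
Definition vec A : spaceN R n := \pi_(spaceN R n) (\row_i (i \in A)%:R).

Lemma toNR_lat A : toNR R (lat A) = vec A.
Proof.
by rewrite toNR_pi; congr (\pi_ _ _); apply/matrixP=> k i; rewrite !mxE; case: (_ \in _).
Qed.

Lemma dif_vec i j A : dif i j (vec A) = (i \in A)%:R - (j \in A)%:R.
Proof. by rewrite dif_pi !mxE. Qed.

Lemma dif_lat i j A : dif i j (lat A) = (i \in A)%:R - (j \in A)%:R.
Proof. by rewrite dif_pi !mxE. Qed.

Lemma dif_toNR i j (v : latN n) : dif i j (toNR R v) = (dif i j v)%:~R.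
Proof. by elim/quotW: v => z; rewrite toNR_pi !dif_pi !mxE rmorphB. Qed.

Lemma toNR_inj : injective (@toNR R n).
Proof.
move=> v w Hvw; apply: dif_inj => i j.
by apply: (@intr_inj R); rewrite -!dif_toNR Hvw.
Qed.

Lemma toNRD (v w : latN n) : toNR R (v + w) = toNR R v + toNR R w.
Proof. by apply: dif_inj => i j; rewrite !(linearD, dif_toNR) /= rmorphD /= !dif_toNR. Qed.

Lemma toNR0 : toNR R 0 = 0 :> spaceN R n.
Proof. by apply: (@addIr _ (toNR R 0)); rewrite -toNRD !add0r. Qed.

Definition nontrivial A := [exists i, [exists j, (i \in A) && (j \notin A)]].

Lemma nontrivialP A : reflect (exists i j, i \in A /\ j \notin A) (nontrivial A).
Proof.
apply: (iffP existsP) => [[i /existsP[j /andP[]]]|[i [j [iA jA]]]]; first by exists i, j.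
by exists i; apply/existsP; exists j; rewrite iA.
Qed.

Lemma lat_inj A B : nontrivial A -> nontrivial B -> lat A = lat B -> A = B.
Proof.
move=> /nontrivialP[i [j [iA jA]]] /nontrivialP[k [l [kB lB]]] HAB.
have H x y : (x \in A)%:R - (y \in A)%:R = (x \in B)%:R - (y \in B)%:R :> int.
  by rewrite -!dif_lat HAB.
have lr x : (x \in A) = (x \in B); last by apply/setP.
have := H x i; have := H x j; have := H x k; have := H x l; have := H i j.
have := H k l.
rewrite iA (negbTE jA) kB (negbTE lB).
by do 6!(case: (_ \in _)).
Qed.

Lemma vec_neq0 A : nontrivial A -> vec A != 0.
Proof.
move=> /nontrivialP[i [j [iA jA]]]; apply/eqP=> H.
have := dif_vec i j A; rewrite H linear0 iA (negbTE jA) subr0 => /esym/eqP.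
by rewrite oner_eq0.
Qed.

Lemma lat_neq0 A : nontrivial A -> lat A != 0.
Proof. by move=> /vec_neq0; apply: contra_neq => H; rewrite -toNR_lat H toNR0. Qed.

Definition comb (lam : P -> R) : spaceN R n := \sum_A lam A *: vec A.

Definition nonneg_on S (lam : P -> R) :=
  (forall A, 0 <= lam A) /\ (forall A, A \notin S -> lam A = 0).

Definition pcone S : set (spaceN R n) :=
  [set x | exists2 lam, nonneg_on S lam & x = comb lam].

Lemma combD lam mu : comb (fun A => lam A + mu A) = comb lam + comb mu.
Proof. by rewrite -big_split; apply: eq_bigr => A _; rewrite scalerDl. Qed.

Lemma combZ c lam : comb (fun A => c * lam A) = c *: comb lam.
Proof. by rewrite scaler_sumr; apply: eq_bigr => A _; rewrite scalerA. Qed.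

Lemma comb1 A : comb (fun B => (B == A)%:R) = vec A.
Proof.
rewrite /comb (bigD1 A) //= eqxx scale1r big1 ?addr0 // => B /negbTE ->.
by rewrite scale0r.
Qed.

Lemma comb_lin (u : {scalar spaceN R n}) lam : u (comb lam) = \sum_A lam A * u (vec A).
Proof. by rewrite linear_sum; apply: eq_bigr => A _; rewrite linearZ. Qed.

Lemma comb_dif i j lam : dif i j (comb lam) = \sum_A lam A * dif i j (vec A).
Proof. by rewrite linear_sum; apply: eq_bigr => A _; rewrite linearZ. Qed.

Lemma nonneg_onD S lam mu : nonneg_on S lam -> nonneg_on S mu ->
  nonneg_on S (fun A => lam A + mu A).
Proof.
move=> [l0 lS] [m0 mS]; split=> A; first exact: addr_ge0.
by move=> AS; rewrite lS // mS // addr0.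
Qed.

Lemma nonneg_onZ S c lam : 0 <= c -> nonneg_on S lam -> nonneg_on S (fun A => c * lam A).
Proof.
move=> c0 [l0 lS]; split=> A; first exact: mulr_ge0.
by move=> AS; rewrite lS // mulr0.
Qed.

Lemma nonneg_on1 S A : A \in S -> nonneg_on S (fun B => (B == A)%:R).
Proof.
move=> AS; split=> B; first exact: ler0n.
by move=> BS; rewrite eq_sym (negbTE (memPn BS _ AS)).
Qed.

Lemma nonneg_on_sub S T lam : S \subset T -> nonneg_on S lam -> nonneg_on T lam.
Proof.
move=> ST [l0 lS]; split=> // A AT; apply: lS.
by apply: contraNN AT; apply: (fintype.subsetP ST).
Qed.

Lemma pconeD S x y : pcone S x -> pcone S y -> pcone S (x + y).
Proof.
by move=> [l ? ->] [m ? ->]; exists (fun A => l A + m A); rewrite ?combD //; apply: nonneg_onD.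
Qed.

Lemma pconeZ S c x : 0 <= c -> pcone S x -> pcone S (c *: x).
Proof.
by move=> c0 [l ? ->]; exists (fun A => c * l A); rewrite ?combZ //; apply: nonneg_onZ.
Qed.

Lemma pcone_vec S A : A \in S -> pcone S (vec A).
Proof. by move=> AS; exists (fun B => (B == A)%:R); [apply: nonneg_on1 | rewrite comb1]. Qed.

Lemma pcone0 S : pcone S 0.
Proof.
exists (fun=> 0); first by split.
by rewrite /comb big1 // => A _; rewrite scale0r.
Qed.

Lemma pcone_sub S T : S \subset T -> pcone S `<=` pcone T.
Proof. by move=> ST x [l Hl ->]; exists l => //; apply: nonneg_on_sub Hl. Qed.

Lemma pcone_min S (C : set (spaceN R n)) :
  (C 0) -> (forall x y, C x -> C y -> C (x + y)) ->
  (forall c x, 0 <= c -> C x -> C (c *: x)) ->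
  (forall A, A \in S -> C (vec A)) -> pcone S `<=` C.
Proof.
move=> C0 CD CZ CS x [l [l0 lS] ->]; apply: (big_ind C) => // A _.
have [AS|/lS ->] := boolP (A \in S); last by rewrite scale0r.
by apply: CZ => //; apply: CS.
Qed.

(** Coefficients indexed by lattice points and by subsets correspond because
    [lat] is injective on nontrivial subsets. *)
Lemma cone_lat S : (forall A, A \in S -> nontrivial A) ->
  @cone R n [set lat A | A in [set` S]] = pcone S.
Proof.
move=> pS.
have inj : set_inj [set` S] lat.
  by move=> A B /set_mem /= AS /set_mem /= BS; apply: lat_inj; apply: pS.
have E (F : latN n -> spaceN R n) :
    \sum_(v \in [set lat A | A in [set` S]]) F v = \sum_(A in S) F (lat A).
  rewrite fsbig_image //.
  have -> : [set` S] = [set` enum S] by apply/seteqP; split=> A /=; rewrite mem_enum.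
  by rewrite -fsbig_seq ?enum_uniq // big_enum.
apply/seteqP; split=> x.
  move=> [l l0 ->]; exists (fun A => if A \in S then l (lat A) else 0).
    split=> A; last by move/negbTE ->.
    by case: ifP => // AS; apply: l0; exists A.
  rewrite E /comb big_mkcond; apply: eq_bigr => A _; case: ifP => AS.
    by rewrite toNR_lat.
  by rewrite scale0r.
move=> [l [l0 lS] ->].
exists (fun v => \sum_(A in S | lat A == v) l A); first by move=> v _; apply: sumr_ge0.
rewrite E /comb [RHS]big_mkcond; apply: eq_bigr => A _; case: ifP => AS.
  rewrite toNR_lat (bigD1 A) ?AS ?eqxx //= big1 ?addr0 // => B /andP[/andP[BS /eqP HB]].
  by rewrite (lat_inj (pS _ BS) (pS _ AS) HB) eqxx.
by rewrite lS ?AS // scale0r.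
Qed.
End IndicatorClasses.

(** * Faces and generators of simplicial cones *)
Section ConesAndFaces.
Variables (R : realType) (n : nat).
Local Notation P := {set 'I_n}.
Local Notation V := (spaceN R n).
Implicit Types (A B : P) (S T : {set P}) (i j : 'I_n) (lam mu : P -> R).

Lemma scalar_pack (f : V -> R) : linear_for *%R f -> exists g : {scalar V}, g =1 f.
Proof.
move=> lin; pose m := GRing.isLinear.Build R V R *%R f lin.
by exists (HB.pack_for {scalar V} f m).
Qed.

(** Linear independence in dual form: these functionals are the ones that expose
    the faces of the cone. *)
Definition indep S := forall A, A \in S ->
  exists2 u : {scalar V}, u (vec R A) = 1 & forall B, B \in S -> B != A -> u (vec R B) = 0.

Lemma indep_sub S T : S \subset T -> indep T -> indep S.
Proof.
move=> ST iT A AS; have [u uA uT] := iT A (fintype.subsetP ST _ AS); exists u => // B BS.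
exact/uT/(fintype.subsetP ST).
Qed.

Lemma indep_inj S lam mu : indep S -> (forall A, A \notin S -> lam A = 0) ->
  (forall A, A \notin S -> mu A = 0) -> comb lam = comb mu -> lam =1 mu.
Proof.
move=> iS lS mS Hlm A; have [AS|AS] := boolP (A \in S); last by rewrite lS ?mS.
have [u uA uS] := iS A AS.
suff H nu : (forall A, A \notin S -> nu A = 0) -> u (comb nu) = nu A.
  by rewrite -H // Hlm H.
move=> nS; rewrite comb_lin (bigD1 A) //= uA mulr1 big1 ?addr0 // => B BA.
have [BS|BS] := boolP (B \in S); first by rewrite uS ?mulr0.
by rewrite nS ?mul0r.
Qed.

Lemma pcone_ge0 S (u : {scalar V}) x :
  (forall A, A \in S -> 0 <= u (vec R A)) -> pcone S x -> 0 <= u x.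
Proof.
move=> uS [l [l0 lS] ->]; rewrite comb_lin; apply: sumr_ge0 => A _.
have [AS|/lS ->] := boolP (A \in S); last by rewrite mul0r.
by rewrite mulr_ge0 ?uS.
Qed.

Lemma nonneg_on_pcone0 S lam (u : {scalar V}) : nonneg_on S lam ->
  (forall A, A \in S -> 0 <= u (vec R A)) -> u (comb lam) = 0 ->
  forall A, u (vec R A) != 0 -> lam A = 0.
Proof.
move=> [l0 lS] uS /eqP; rewrite comb_lin psumr_eq0 => [/allP H A uA|A _].
  by have := H A (mem_index_enum _); rewrite /= mulf_eq0 (negbTE uA) orbF => /eqP.
have [AS|AS] := boolP (A \in S); first by rewrite mulr_ge0 ?uS.
by rewrite lS // mul0r.
Qed.

Lemma face_of_pcone S (u : {scalar V}) : (forall x, pcone S x -> 0 <= u x) ->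
  [set x | pcone S x /\ u x = 0] = pcone [set A in S | u (vec R A) == 0]%SET.
Proof.
move=> u0; apply/seteqP; split=> x.
  move=> [[l [l0 lS] ->] ux]; exists l => //; split=> // A.
  rewrite inE negb_and => /orP[/lS //|]; apply: (nonneg_on_pcone0 (S := S)) => //.
  by move=> B BS; apply/u0/pcone_vec.
move=> [l [l0 lS] ->]; split.
  exists l => //; split=> // A AS; apply: lS; rewrite inE (negbTE AS) //.
rewrite comb_lin big1 // => A _.
have [|/lS ->] := boolP (A \in [set A in S | u (vec R A) == 0]%SET); last by rewrite mul0r.
by rewrite inE => /andP[_ /eqP ->]; rewrite mulr0.
Qed.

Lemma face_sub_pcone S tau : is_face tau (pcone S) ->
  exists2 S' : {set P}, S' \subset S & tau = @pcone R n S'.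
Proof.
move=> [u u0 ->]; rewrite face_of_pcone //; eexists; last by [].
by apply/fintype.subsetP => A; rewrite inE => /andP[].
Qed.

(** Summing the coordinate functionals of the generators outside [S'] gives a
    functional that is positive on them and vanishes on [S']. *)
Lemma indep_separate S S' : indep S -> S' \subset S ->
  exists u : {scalar V}, forall A, A \in S -> u (vec R A) = (A \notin S')%:R.
Proof.
move=> iS SS.
have /choice[U HU] : forall A, exists u : {scalar V}, A \in S ->
    u (vec R A) = 1 /\ forall B, B \in S -> B != A -> u (vec R B) = 0.
  move=> A; have [AS|AS] := boolP (A \in S); last first.
    by have [f _] := scalar_pack (fun _ _ _ => esym (etrans (addr0 _) (mulr0 _))); exists f.
  by have [u uA uS] := iS A AS; exists u.
have [|u Hu] := @scalar_pack (fun x => \sum_(A in S | A \notin S') U A x).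
  move=> a x y; rewrite mulr_sumr -big_split; apply: eq_bigr => A _.
  by rewrite linearP.
exists u => A AS; rewrite Hu; have [AS'|AS'] := boolP (A \in S').
  rewrite big1 // => B /andP[BS BS']; have [_ ->] // := HU B BS.
  by apply: contraNneq BS' => <-.
rewrite (bigD1 A) ?AS //= (HU A AS).1 big1 ?addr0 // => B /andP[/andP[BS BS'] BA].
by have [_ ->] // := HU B BS; rewrite eq_sym.
Qed.

Lemma pcone_sub_face S S' : indep S -> S' \subset S -> is_face (@pcone R n S') (pcone S).
Proof.
move=> iS SS; have [u Hu] := indep_separate iS SS.
have u0 x : pcone S x -> 0 <= u x.
  by apply: pcone_ge0 => A AS; rewrite Hu.
exists u => //; rewrite face_of_pcone //; congr pcone; apply/setP => A; rewrite inE.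
have [AS|AS] := boolP (A \in S); first by rewrite Hu //;
  case: (A \in S'); rewrite /= ?eqxx ?oner_eq0.
by apply/negbTE; apply: contraNN AS; apply: (fintype.subsetP SS).
Qed.

(** When [A] is in [S], this says that [vec A] spans an exposed ray of
    [pcone S], distinct from the other generators. *)
Definition exposed S A := exists2 u : {scalar V}, u (vec R A) = 0 &
  forall B, B \in S -> B != A -> 0 < u (vec R B).

Lemma indep_exposed S A : indep S -> A \in S -> exposed S A.
Proof.
move=> iS AS; have [|u Hu] := @indep_separate S [set A]%SET iS; first by rewrite finset.sub1set.
exists u; first by rewrite Hu // inE eqxx.
by move=> B BS BA; rewrite Hu // inE BA ltr01.
Qed.

(** [vec A] is primitive: a coordinate difference equal to [1] on it takes the
    integral value [c] on [v]. *)
Lemma dif_lat_ge1 A (v : latN n) (c : R) : nontrivial A -> v != 0 -> 0 <= c ->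
  toNR R v = c *: vec R A -> 1 <= c.
Proof.
move=> /nontrivialP[i [j [iA jA]]] v0 c0 Hv.
have := congr1 (dif i j) Hv; rewrite dif_toNR linearZ /= dif_vec iA (negbTE jA) subr0 mulr1.
move=> Hc; move: c0; rewrite le_eqVlt => /predU1P[c0|]; last first.
  by rewrite -Hc -[X in _ -> X <= _]/(1%:~R) ltr0z ler_int.
case/eqP: v0; apply: (@toNR_inj R); by rewrite Hv -c0 scale0r toNR0.
Qed.

Lemma exposed_ray S A (u : {scalar V}) : A \in S -> u (vec R A) = 0 ->
  (forall B, B \in S -> B != A -> 0 < u (vec R B)) ->
  [set x | pcone S x /\ u x = 0] = [set c *: vec R A | c in [set c : R | 0 <= c]].
Proof.
move=> AS uA uS; have u0 x : pcone S x -> 0 <= u x.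
  apply: pcone_ge0 => B BS.
  by have [->|BA] := eqVneq B A; rewrite ?uA // ltW ?uS.
rewrite face_of_pcone //.
have -> : [set B in S | u (vec R B) == 0]%SET = [set A]%SET.
  apply/setP=> B; rewrite !inE; have [->|BA] := eqVneq B A; first by rewrite AS uA eqxx.
  have [BS|//] := boolP (B \in S).
  by rewrite gt_eqF // uS.
apply/seteqP; split=> x; last first.
  by move=> [c /= c0 <-]; apply: pconeZ => //; apply: pcone_vec; rewrite inE.
move=> [l [l0 lS] ->]; exists (l A) => //=.
rewrite /comb (bigD1 A) //= big1 ?addr0 // => B BA.
by rewrite lS ?scale0r // inE.
Qed.

(** A ray face of [pcone S] contains some [vec A], and both it and the minimal
    lattice point of the ray are primitive, so they agree. *)
Lemma gens_pcone S : (forall A, A \in S -> nontrivial A) ->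
  (forall A, A \in S -> exposed S A) -> gens (@pcone R n S) = [set lat A | A in [set` S]].
Proof.
move=> pS eS; apply/seteqP; split=> v.
  move=> [rho [[u u0 ->] _ [v0 rv vmin]]]; move: rv vmin; rewrite face_of_pcone //.
  set S0 := (X in pcone X) => rv vmin.
  have [A AS0] : exists A, A \in S0.
    apply: contrapT => H; case/eqP: v0; apply: (@toNR_inj R).
    case: rv => l [l0 lS] ->; rewrite /comb big1 => [|A _]; first by rewrite toNR0.
    by rewrite lS ?scale0r //; apply/negP => HA; apply: H; exists A.
  have AS : A \in S by move: AS0; rewrite inE => /andP[].
  have [] := vmin (lat A); first exact/lat_neq0/pS.
    by rewrite toNR_lat; apply: pcone_vec.
  move=> c c1; rewrite toNR_lat => Hc.
  have c0 : 0 < c by apply: lt_le_trans c1.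
  have : 1 <= c^-1.
    apply: (dif_lat_ge1 (pS _ AS) v0); first by rewrite invr_ge0 ltW.
    by rewrite Hc scalerA mulVf ?scale1r // gt_eqF.
  rewrite invf_ge1 // => c1'; exists A => //.
  apply: (@toNR_inj R); rewrite toNR_lat Hc.
  have c_1 : c = 1 by apply/eqP; rewrite eq_le c1 c1'.
  by rewrite c_1 scale1r.
move=> [A /= AS <-].
have [u uA uS] := eS A AS; have pA := pS _ AS.
exists [set x | pcone S x /\ u x = 0]; split; rewrite ?(exposed_ray AS uA uS) //.
- exists u; last by rewrite (exposed_ray AS uA uS).
  move=> x; apply: pcone_ge0 => B BS.
  by have [->|BA] := eqVneq B A; rewrite ?uA // ltW ?uS.
- by exists (vec R A) => //; apply: vec_neq0.
- split; [exact: lat_neq0 | by exists 1; rewrite ?scale1r ?toNR_lat //= ler01 |].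
  move=> w w0 [c /= c0 Hc]; exists c; last by rewrite toNR_lat Hc.
  exact: (dif_lat_ge1 pA w0 c0 (esym Hc)).
Qed.

End ConesAndFaces.

(** * Chambers of the braid arrangement *)
Section Chambers.
Variables (R : realType) (n : nat).
Local Notation P := {set 'I_n}.
Local Notation V := (spaceN R n).
Implicit Types (A B : P) (S T : {set P}) (i j : 'I_n) (lam mu : P -> R) (w : 'S_n).

Lemma chamberP w (x : V) :
  chamber w x <-> forall i j, (i <= j)%N -> 0 <= dif (w j) (w i) x.
Proof.
split=> [[y wy <-] i j ij|]; first by rewrite dif_pi subr_ge0 wy.
elim/quotW: x => y wy; exists y => // i j ij.
by have := wy i j ij; rewrite dif_pi subr_ge0.
Qed.

Lemma chamberD w (x y : V) : chamber w x -> chamber w y -> chamber w (x + y).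
Proof.
by move=> /chamberP wx /chamberP wy; apply/chamberP=> i j ij; rewrite linearD addr_ge0 ?wx ?wy.
Qed.

Lemma chamberZ w c (x : V) : 0 <= c -> chamber w x -> chamber w (c *: x).
Proof.
by move=> c0 /chamberP wx; apply/chamberP=> i j ij; rewrite linearZ mulr_ge0 ?wx.
Qed.

Lemma chamber0 w : chamber w (0 : V).
Proof. by apply/chamberP=> i j ij; rewrite linear0. Qed.

Lemma chamber_dif_sign w i j :
  (forall x : V, chamber w x -> 0 <= dif i j x) \/ (forall x : V, chamber w x -> dif i j x <= 0).
Proof.
rewrite -(permKV w i) -(permKV w j).
have [ji|ij] := leqP ((w^-1)%g j) ((w^-1)%g i); [left|right] => x /chamberP; first exact.
by rewrite difC oppr_le0; apply; apply: ltnW.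
Qed.

Lemma chamber_cover (x : V) : exists w, chamber w x.
Proof.
elim/quotW: x => y.
pose r := fun i j => y 0 i <= y 0 j.
have rT : transitive r by move=> j i k; apply: le_trans.
have rtot : total r by move=> i j; apply: le_total.
pose s := sort r (enum 'I_n).
have ss : size s = n by rewrite size_sort size_enum_ord.
have us : uniq s by rewrite sort_uniq enum_uniq.
have inj : injective (fun i : 'I_n => nth i s i).
  move=> i j; rewrite (set_nth_default j) ?ss // => /eqP.
  by rewrite nth_uniq ?ss // => /eqP/val_inj.
exists (perm inj); apply/chamberP=> i j ij; rewrite dif_pi subr_ge0 !permE.
rewrite [X in _ <= y _ X](set_nth_default i) ?ss //.
have rR : reflexive r by move=> k; apply: lexx.
by apply: (sorted_leq_nth rT rR i (sort_sorted rtot _)); rewrite ?inE ?ss.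
Qed.

(** The generators of the chamber of [w]: the nontrivial upper sets of the order
    that [w] puts on the coordinates. *)
Definition flag w : {set P} :=
  [set A : P | nontrivial A &
    [forall i : 'I_n, forall j : 'I_n, (i <= j)%N ==> (w i \in A) ==> (w j \in A)]]%SET.

Lemma chamber_vec w A : (forall i j, (i <= j)%N -> w i \in A -> w j \in A) <-> chamber w (vec R A).
Proof.
split=> [wA|/chamberP wA i j ij iA].
  apply/chamberP=> i j ij; rewrite dif_vec subr_ge0 ler_nat.
  by case: (boolP (w i \in A)) => // /(wA i j ij) ->.
have := wA i j ij; rewrite dif_vec iA; case: (_ \in _) => //.
by rewrite /= sub0r oppr_ge0 ler10.
Qed.

Lemma flagP w A : reflect (nontrivial A /\ chamber w (vec R A)) (A \in flag w).
Proof.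
rewrite inE; apply: (iffP andP) => [][-> H]; split=> //.
  by apply/chamber_vec=> i j ij iA; move/forallP/(_ i)/forallP/(_ j): H; rewrite ij iA.
apply/forallP=> i; apply/forallP=> j; apply/implyP => ij; apply/implyP.
by have := (chamber_vec w A).2 H i j ij.
Qed.

Lemma vec_setT : vec R [set: 'I_n]%SET = 0.
Proof. by apply: dif_inj => i j; rewrite dif_vec linear0 !inE subrr. Qed.

(** Abel summation: the coefficients of a sorted vector on the upper sets of [w]
    are its successive increments. *)
Lemma chamber_pcone w : chamber w = pcone (R := R) (flag w).
Proof.
apply/seteqP; split=> [x|]; last first.
  apply: pcone_min; [exact: chamber0|exact: chamberD|exact: chamberZ|].
  by move=> A /flagP[].
move=> [y wy <-] {x}.
pose g m := if insub m is Some k then y 0 (w k) else 0.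
have gE (k : 'I_n) : g k = y 0 (w k) by rewrite /g valK.
pose c m := g m - (if m is m'.+1 then g m' else 0).
pose F k : P := [set i | (k <= (w^-1)%g i)%N]%SET.
have -> : \pi_V y = \sum_(k < n) c k *: vec R (F k).
  have -> : \sum_(k < n) c k *: vec R (F k) =
      \pi_V (\sum_(k < n) c k *: (\row_i (i \in F k)%:R)).
    elim/big_ind2: _ => [|u u' v v' -> ->|k _]; rewrite ?pi_onesD ?pi_onesZ //.
    by rewrite -[RHS]/(\pi_V 0) pi_quot_zero.
  congr (\pi_V _); apply/matrixP=> z i; rewrite (ord1 z) summxE.
  have := permKV w i; set j := (w^-1)%g i => <-.
  transitivity (\sum_(k < n | (k < j.+1)%N) c k).
    rewrite -(big_ord_widen n c (ltn_ord j)).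
    rewrite -gE; elim: (nat_of_ord j) => [|m IH]; first by rewrite big_ord1 /c subr0.
    by rewrite big_ord_recr /= -IH /c addrC subrK.
  rewrite big_mkcond; apply: eq_bigr => k _; rewrite !mxE inE permK ltnS.
  by case: leqP; rewrite ?mulr1 ?mulr0.
apply: (big_ind (pcone (R := R) (flag w))); [exact: pcone0|exact: pconeD|].
move=> k _; have [k0|k0] := posnP k.
  have -> : F k = [set: 'I_n]%SET by apply/setP=> i; rewrite !inE k0.
  by rewrite vec_setT scaler0; apply: pcone0.
have kn : (k.-1 < n)%N by rewrite (leq_ltn_trans (leq_pred _)).
apply: pconeZ.
  have -> : c k = y 0 (w k) - y 0 (w (Ordinal kn)).
    by rewrite -!gE /c /=; case: (nat_of_ord k) k0.
  by rewrite subr_ge0 wy //= leq_pred.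
apply/pcone_vec/flagP; split.
  apply/nontrivialP; exists (w k), (w (Ordinal kn)).
  by rewrite !inE !permK leqnn -ltnNge /= prednK.
by apply/chamber_vec=> i j ij; rewrite !inE !permK => /leq_trans; apply.
Qed.

(** An interior point of the chamber of [w]. *)
Definition rank_pt w : V := \pi_V (\row_i (((w^-1)%g i)%:R)).

Lemma dif_rank_pt w i j : dif (w j) (w i) (rank_pt w) = j%:R - i%:R.
Proof. by rewrite dif_pi !mxE !permK. Qed.

Lemma chamber_rank_pt w : chamber w (rank_pt w).
Proof. by apply/chamberP=> i j ij; rewrite dif_rank_pt subr_ge0 ler_nat. Qed.

Lemma perm_homo_le_id w : {homo w : i j / (i <= j)%N} -> w = 1%g.
Proof.
have geq (v : 'I_n -> 'I_n) : {homo v : i j / (i < j)%N} -> forall i, (i <= v i)%N.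
  move=> mv i; suff H m : forall i, nat_of_ord i = m -> (m <= v i)%N by apply: H.
  elim: m {i} => // m IH i im.
  have mn : (m < n)%N by rewrite ltnW // -im ltn_ord.
  apply: leq_ltn_trans (mv (Ordinal mn) i _); last by rewrite im.
  exact: IH.
move=> mw; have mw1 i j : (i < j)%N -> (w i < w j)%N.
  move=> ij; rewrite ltn_neqAle mw ?(ltnW ij) // andbT.
  by apply: contraTneq ij => /val_inj/perm_inj ->; rewrite ltnn.
have mw2 i j : (i < j)%N -> ((w^-1)%g i < (w^-1)%g j)%N.
  apply: contraTT; rewrite -!leqNgt => /mw; by rewrite !permKV.
apply/permP=> i; rewrite perm1; apply/val_inj/eqP; rewrite eqn_leq (geq w mw1) // andbT.
by have := geq (w^-1)%g mw2 (w i); rewrite permK.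
Qed.

Lemma chamber_rank_pt_eq w w' : chamber w' (rank_pt w) -> w' = w.
Proof.
move=> /chamberP ww'; apply/eqP; rewrite eq_mulgV1; apply/eqP/perm_homo_le_id => i j ij.
have := ww' i j ij; rewrite /rank_pt dif_pi !mxE subr_ge0 ler_nat.
by rewrite !permM.
Qed.

(** Adding a large multiple of an interior point moves any point into the
    chamber. *)
Lemma span_chamber w (x : V) : exists y z, [/\ chamber w y, chamber w z & x = y - z].
Proof.
pose N := \sum_i \sum_j `|dif i j x|.
have N0 : 0 <= N by apply: sumr_ge0 => i _; apply: sumr_ge0.
exists (x + N *: rank_pt w), (N *: rank_pt w); rewrite addrK; split=> //; last first.
  by apply: chamberZ => //; apply: chamber_rank_pt.
apply/chamberP=> i j; rewrite leq_eqVlt => /predU1P[/val_inj ->|ij].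
  by rewrite /dif subrr.
rewrite linearD linearZ /= dif_rank_pt.
have H1 : N <= N * (j%:R - i%:R) by rewrite ler_peMr // lerBrDr -[1]/(1%:R) -natrD ler_nat.
have H2 : - dif (w j) (w i) x <= N.
  apply: le_trans (ler_norm _) _; rewrite normrN.
  rewrite /N (bigD1 (w j)) //= (bigD1 (w i)) //= -addrA lerDl.
  by apply: addr_ge0; apply: sumr_ge0 => // k _; apply: sumr_ge0.
by rewrite -(opprK (dif _ _ x)) addrC subr_ge0 (le_trans H2).
Qed.
End Chambers.

(** * Simplicial complexes coarsening the braid fan *)
Section BraidComplexes.
Variables (R : realType) (n : nat).
Local Notation P := {set 'I_n}.
Local Notation V := (spaceN R n).
Implicit Types (A B : P) (S T : {set P}) (i j : 'I_n) (lam mu : P -> R) (w : 'S_n).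

(** [bc_uniq] says both that the generators of a face are independent and that
    cones over faces meet along common faces; [bc_cover] says that the cones over
    faces are coarser than the braid fan, hence cover the space. *)
Record braid_complex (K : {set {set P}}) : Prop := BraidComplex {
  bc_nontrivial : forall S A, S \in K -> A \in S -> nontrivial A;
  bc_down : forall S T, S \in K -> T \subset S -> T \in K;
  bc_uniq : forall S T lam mu, S \in K -> T \in K ->
    nonneg_on S lam -> nonneg_on T mu -> comb lam = comb mu -> lam =1 mu;
  bc_cover : forall w, exists2 S, S \in K & chamber w `<=` @pcone R n S }.

(** Viewing [S] as the edge set of a tree, [a -> b] are the end points of the
    edge [A], and the members of [S] are the far sides of the edges. *)
Definition edge S A a b :=
  [/\ a \notin A, b \in A & forall B, B \in S -> B != A -> (a \in B) = (b \in B)].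

Lemma edge_dif S A a b B : edge S A a b -> B \in S -> dif b a (vec R B) = (B == A)%:R.
Proof.
move=> [aA bA aS] BS; rewrite dif_vec; have [->|/(aS B BS) ->] := eqVneq B A.
  by rewrite bA (negbTE aA) subr0.
by rewrite subrr.
Qed.

Lemma edge_dif_lat S A a b B : edge S A a b -> B \in S -> dif b a (lat B) = (B == A)%:R.
Proof.
move=> [aA bA aS] BS; rewrite dif_lat; have [->|/(aS B BS) ->] := eqVneq B A.
  by rewrite bA (negbTE aA) subr0.
by rewrite subrr.
Qed.

Lemma edge_dif_comb S A a b lam : edge S A a b -> A \in S ->
  (forall B, B \notin S -> lam B = 0) -> dif b a (comb lam) = lam A.
Proof.
move=> eA AS lS; rewrite comb_dif (bigD1 A) //= (edge_dif eA) // eqxx mulr1.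
rewrite big1 ?addr0 // => B BA; have [BS|/lS ->] := boolP (B \in S); last by rewrite mul0r.
by rewrite (edge_dif eA) // (negbTE BA) mulr0.
Qed.

Lemma binary_inj N (f g : 'I_N -> bool) :
  (\sum_(k < N) f k * 2 ^ k = \sum_(k < N) g k * 2 ^ k)%N -> f =1 g.
Proof.
elim: N f g => [|N IH] f g; first by move=> _ [].
rewrite !big_ord_recl !muln1 /=.
have E (h : 'I_N.+1 -> bool) : (\sum_(k < N) h (lift ord0 k) * 2 ^ lift ord0 k =
    (\sum_(k < N) h (lift ord0 k) * 2 ^ k).*2)%N.
  by rewrite -muln2 big_distrl; apply: eq_bigr => k _; rewrite lift0 expnSr mulnA.
rewrite !E => H.
have H0 : f ord0 = g ord0.
  by have := congr1 odd H; rewrite !oddD !odd_double !addbF !oddb.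
have := H; rewrite H0 => /addnI/double_inj/IH Hl k.
by case: (unliftP ord0 k) => [m ->|->].
Qed.

(** A point with distinct integral coordinates stays in its chamber under
    a perturbation that changes coordinate differences by at most one. *)
Lemma sort_ext (q : 'I_n -> nat) w (p x : V) : injective q ->
  (forall i j, dif i j p = (q i)%:R - (q j)%:R) -> (forall i j, dif i j x <= 1) ->
  chamber w p -> chamber w (p + x).
Proof.
move=> qi Hp Hx /chamberP wp; apply/chamberP=> i j; rewrite leq_eqVlt => /predU1P[/val_inj ->|ij].
  by rewrite /dif subrr.
have := wp i j (ltnW ij); rewrite linearD /= Hp subr_ge0 ler_nat leq_eqVlt.
move=> /predU1P[/qi/perm_inj E|H]; first by rewrite E ltnn in ij.
rewrite [dif _ _ x]difC subr_ge0 (le_trans (Hx _ _)) // lerBrDr -[1]/(1%:R) -natrD ler_nat.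
by rewrite add1n.
Qed.

Section Complex.
Variables (K : {set {set P}}) (bK : braid_complex K).

(** Faces with a full-dimensional cone. *)
Definition full S := S \in K /\ exists w, chamber w `<=` @pcone R n S.

Lemma full_separates S i j : full S -> i != j -> exists2 A, A \in S & (i \in A) != (j \in A).
Proof.
move=> [SK [w wS]] ij; apply: contrapT => H.
have [l [l0 lS] Hl] := wS _ (chamber_rank_pt R w).
have : dif i j (rank_pt R w) = 0.
  rewrite Hl comb_dif big1 // => A _; have [AS|/lS ->] := boolP (A \in S); last by rewrite mul0r.
  have [E|E] := eqVneq (i \in A) (j \in A); last by case: H; exists A.
  by rewrite dif_vec E subrr mulr0.
rewrite -(permKV w i) -(permKV w j) dif_rank_pt => /eqP.
rewrite subr_eq0 eqr_nat => /eqP/val_inj/perm_inj E.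
by rewrite E eqxx in ij.
Qed.

(** If the generators other than [A] still separated all pairs of coordinates,
    some positive combination [p] of them would have pairwise distinct
    coordinates, with room for moving by [vec A] in both directions inside one
    chamber.  The cone over that chamber would then contain [vec A] as
    a generator because of [p + vec A], and yet allow [p - vec A]. *)
Lemma full_edge S A : full S -> A \in S -> exists a b, edge S A a b.
Proof.
move=> fS AS; have [SK _] := fS; apply: contrapT => H.
have sep i j : i != j -> exists2 B, B \in (S :\ A)%SET & (i \in B) != (j \in B).
  move=> ij; apply: contrapT => HB.
  have HB' B : B \in S -> B != A -> (i \in B) = (j \in B).
    move=> BS BA; apply: contrapT => /eqP E; apply: HB; exists B => //.
    by rewrite in_setD1 BA.
  have [B BS] := full_separates fS ij.
  have [->|BA] := eqVneq B A; last by rewrite (HB' B BS BA) eqxx.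
  have [iA|iA] := boolP (i \in A); have [jA|jA] := boolP (j \in A) => // _; apply: H.
    by exists j, i; split=> // C CS CA; rewrite HB'.
  by exists i, j; split.
(* Binary weights make the coordinate [q i] of [p] determine which of the other
   generators contain [i]. *)
pose lam0 B : nat := ((B \in S :\ A) * 2 ^ enum_rank B)%N.
pose q i : nat :=
  (\sum_(k < #|{: P}|) ((enum_val k \in S :\ A) && (i \in enum_val k)) * 2 ^ k)%N.
have q_inj : injective q.
  move=> i j; rewrite /q => Hq; have E := binary_inj Hq.
  apply/eqP; apply: contrapT => /negP /sep[B BS] /negP; apply.
  by have := E (enum_rank B); rewrite enum_rankK BS /= => ->.
pose lam B : R := (lam0 B)%:R.
have lam_on : nonneg_on (S :\ A)%SET lam.
  by split=> B; [exact: ler0n | move=> /negbTE BS; rewrite /lam /lam0 BS].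
have lamS := nonneg_on_sub (subsetDl _ _) lam_on.
have Hp i j : dif i j (comb lam) = (q i)%:R - (q j)%:R.
  have E k : (q k)%:R = \sum_B lam B * (k \in B)%:R.
    rewrite (reindex (@enum_val P predT)) /=; last exact: onW_bij (@enum_val_bij P).
    rewrite natr_sum; apply: eq_bigr => m _; rewrite /lam /lam0 enum_valK -natrM mulnAC.
    by congr (_ * _)%:R; case: (_ \in _); case: (_ \in _).
  by rewrite comb_dif !E -sumrB; apply: eq_bigr => B _; rewrite dif_vec mulrBr.
have dA i j : dif i j (vec R A) <= 1.
  by rewrite dif_vec; do 2!case: (_ \in _); rewrite /=; lra.
have dA' i j : dif i j (- vec R A) <= 1.
  by rewrite linearN /= dif_vec; do 2!case: (_ \in _); rewrite /=; lra.
have [w wp] := chamber_cover (comb lam).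
have [T TK wT] := bc_cover bK w.
have [mu muT Hmu] := wT _ (sort_ext q_inj Hp dA wp).
have [nu nuT Hnu] := wT _ (sort_ext q_inj Hp dA' wp).
have lamA : lam A = 0 by apply: lam_on.2; rewrite !inE eqxx.
have AT : A \in T.
  apply: contraT => AT.
  have := bc_uniq bK SK TK (nonneg_onD lamS (nonneg_on1 R AS)) muT.
  rewrite combD comb1 => /(_ Hmu A); rewrite eqxx lamA (muT.2 _ AT) add0r => /eqP.
  by rewrite oner_eq0.
have := bc_uniq bK SK TK lamS (nonneg_onD nuT (nonneg_on1 R AT)).
rewrite combD comb1 -Hnu subrK => /(_ erefl A); rewrite eqxx lamA => E.
by have := nuT.1 A; rewrite leNgt; case/negP; rewrite -(ltrD2r 1) -E add0r ltr01.
Qed.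

Lemma full_indep S : full S -> indep R S.
Proof.
move=> fS A AS; have [a [b e]] := full_edge fS AS.
exists (dif b a : {scalar V}); first by rewrite /= (edge_dif e) // eqxx.
by move=> B BS BA; rewrite /= (edge_dif e) // (negbTE BA).
Qed.

(** The point with all coefficients [1] on [S] lies in some chamber, and that
    chamber in the cone of a full face; by uniqueness this face contains [S]. *)
Lemma full_above S : S \in K -> exists2 T, full T & S \subset T.
Proof.
move=> SK; pose lam A : R := (A \in S)%:R.
have lamS : nonneg_on S lam.
  by split=> A; [exact: ler0n | move=> /negbTE AS; rewrite /lam AS].
have [w wl] := chamber_cover (comb lam).
have [T TK wT] := bc_cover bK w.
exists T; first by split=> //; exists w.
have [mu muT Hmu] := wT _ wl.
apply/fintype.subsetP=> A AS; apply: contraT => /muT.2.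
by rewrite -(bc_uniq bK SK TK lamS muT Hmu) /lam AS => /eqP; rewrite oner_eq0.
Qed.

Lemma bc_indep S : S \in K -> indep R S.
Proof. by move=> /full_above[T fT ST]; apply: indep_sub ST _; apply: full_indep. Qed.

Lemma full_spans S (x : V) : full S ->
  exists2 lam, (forall A, A \notin S -> lam A = 0) & x = comb lam.
Proof.
move=> [SK [w wS]]; have [y [z [wy wz ->]]] := span_chamber w x.
have [l [_ lS] ->] := wS _ wy; have [m [_ mS] ->] := wS _ wz.
exists (fun A => l A + (-1) * m A); last by rewrite combD combZ scaleN1r.
by move=> A AS; rewrite lS ?mS // mulr0 addr0.
Qed.

(** The dual coordinates of a full face are differences of coordinates, so they
    are integral on the lattice. *)
Lemma full_Zbasis S : full S -> exists2 b : seq (latN n), is_Zbasis b &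
  forall A, A \in S -> lat A \in b.
Proof.
move=> fS; pose s := enum S; exists (map (@lat n) s); last first.
  by move=> A AS; apply/mapP; exists A; rewrite ?mem_enum.
set b := map _ s; have sb : size b = size s by rewrite size_map.
pose A_ (i : 'I_(size b)) := nth finset.set0 s i.
have is_ (i : 'I_(size b)) : (i < size s)%N by rewrite -sb.
have bE (i : 'I_(size b)) : b`_i = lat (A_ i) by rewrite /b (nth_map finset.set0).
have AS (i : 'I_(size b)) : A_ i \in S by rewrite -mem_enum mem_nth.
have A_eq (i j : 'I_(size b)) : (A_ i == A_ j) = (i == j) by rewrite nth_uniq ?enum_uniq.
have /choice[e He] : forall i : 'I_(size b), exists ab, edge S (A_ i) ab.1 ab.2.
  by move=> i; have [a0 [b0 ?]] := full_edge fS (AS i); exists (a0, b0).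
have coord (c : {ffun 'I_(size b) -> int}) (i : 'I_(size b)) :
    dif (e i).2 (e i).1 (\sum_j c j *: b`_j) = c i.
  rewrite linear_sum (bigD1 i) //= linearZ /= bE (edge_dif_lat (He i)) // eqxx mulr1.
  rewrite big1 ?addr0 // => j ji; rewrite linearZ /= bE (edge_dif_lat (He i)) //.
  by rewrite A_eq (negbTE ji) mulr0.
move=> v; exists [ffun i => dif (e i).2 (e i).1 v]; split; last first.
  by move=> c ->; apply/ffunP=> i; rewrite ffunE coord.
set c := finfun _; apply/eqP; rewrite -subr_eq0; apply/eqP/(@toNR_inj R); rewrite toNR0.
set x := v - _; have [l lS Hl] := full_spans (toNR R x) fS.
rewrite Hl /comb big1 // => A _; have [AinS|/lS ->] := boolP (A \in S); last by rewrite scale0r.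
have Ai : (index A s < size b)%N by rewrite sb index_mem mem_enum.
have EA : A_ (Ordinal Ai) = A by rewrite /A_ nth_index // mem_enum.
rewrite -{1}EA -(edge_dif_comb (He (Ordinal Ai)) (AS _) lS).
by rewrite -Hl dif_toNR linearB /= coord ffunE subrr scale0r.
Qed.

(** Both sides of [vec (A :&: B) + vec (A :|: B) = vec A + vec B] are positive
    combinations over cones of the complex, so the summands on the left are
    combinations of [vec A] and [vec B]; comparing coordinates shows that this
    needs one of the four regions cut out by [A] and [B] to be empty. *)
Lemma bc_laminar S A B : S \in K -> A \in S -> B \in S ->
  [\/ A \subset B, B \subset A, A :&: B = finset.set0 | A :|: B = [set: 'I_n]%SET].
Proof.
move=> SK AS BS.
have [sub|/subsetPn[i iA iB]] := boolP (A \subset B); first by constructor 1.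
have [sub|/subsetPn[j jB jA]] := boolP (B \subset A); first by constructor 2.
have [->|/set0Pn[k kI]] := eqVneq (A :&: B) finset.set0; first by constructor 3.
have [|lU] := eqVneq (A :|: B) [set: 'I_n]%SET; first by constructor 4.
have {lU} [l lU] : exists l, l \notin A :|: B.
  apply: contrapT => H; case/eqP: lU; apply/setP => l; rewrite [RHS]inE.
  by apply: contrapT => /negP lU; apply: H; exists l.
exfalso.
have AB : A != B by apply: contraNneq iB => <-.
have E : vec R (A :&: B) + vec R (A :|: B) = vec R A + vec R B.
  apply: dif_inj => x y; rewrite !linearD /= !dif_vec !inE.
  by do 4!case: (_ \in _); rewrite /=; lra.
have [w wx] := chamber_cover (vec R (A :&: B) + vec R (A :|: B)).
have [wI wU] : chamber w (vec R (A :&: B)) /\ chamber w (vec R (A :|: B)).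
  split; apply/chamberP => x y /((chamberP _ _).1 wx x y);
  rewrite linearD /= !dif_vec !inE; do 4!(case: (_ \in _)); rewrite //=; lra.
have [T TK wT] := bc_cover bK w.
have [mu muT Hmu] := wT _ wI; have [nu nuT Hnu] := wT _ wU.
have := bc_uniq bK TK SK (nonneg_onD muT nuT)
  (nonneg_onD (nonneg_on1 R AS) (nonneg_on1 R BS)).
rewrite !combD !comb1 -Hmu -Hnu => /(_ E) H.
have mu0 X : X != A -> X != B -> mu X = 0.
  move=> /negbTE XA /negbTE XB; have := H X; rewrite XA XB addr0 => /eqP.
  by rewrite paddr_eq0 ?(muT.1) ?(nuT.1) // => /andP[/eqP].
have D x y : dif x y (vec R (A :&: B)) = mu A * dif x y (vec R A) + mu B * dif x y (vec R B).
  rewrite Hmu comb_dif (bigD1 A) //= (bigD1 B) 1?eq_sym //= addrA [X in _ + X]big1 ?addr0 //.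
  by move=> X /andP[XA XB]; rewrite mu0 ?mul0r.
have := D k l; have := D i l; have := D j l; rewrite !dif_vec.
move: kI lU; rewrite !inE negb_or => /andP[-> ->] /andP[/negbTE -> /negbTE ->].
rewrite iA jB (negbTE iB) (negbTE jA) /=.
clear; lra.
Qed.
End Complex.
End BraidComplexes.

(** * Laminar families and star subdivision of a complex *)
Section LaminarFamilies.
Variable n : nat.
Local Notation P := {set 'I_n}.
Implicit Types (A B X : P) (S : {set P}).

Definition laminar S := forall A B, A \in S -> B \in S ->
  [\/ A \subset B, B \subset A, A :&: B = finset.set0 | A :|: B = [set: 'I_n]%SET].

Definition separating S := forall i j : 'I_n, i != j ->
  exists2 A, A \in S & (i \in A) != (j \in A).

(** Neither [A] nor [B] contains [a] or [a'].  Since [X] contains [a], it contains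
    [b] and meets [A]; since it avoids [a'], it avoids [b'] and does not contain
    [B].  This leaves one relative position for each of the pairs [(A, X)] and
    [(B, X)]. *)
Lemma disjoint_grow_half S A B X a b a' b' : laminar S -> A \in S -> B \in S -> X \in S ->
  A :&: B = finset.set0 -> edge S A a b -> edge S B a' b' -> a \in X -> a' \notin X ->
  A \proper X /\ X :&: B = finset.set0.
Proof.
move=> lS AS BS XS AB [aA bA eA] [a'B b'B eB] aX a'X.
have dis x : x \in A -> x \in B -> False.
  by move=> xA xB; have := finset.in_set0 x; rewrite -AB inE xA xB.
have AnB : A != B by apply: contraTneq bA => AB'; apply/negP => bA;
  apply: (dis b); rewrite -?AB'.
have XA : X != A by apply: contraNneq aA => <-.
have aB : a \notin B by rewrite (eA _ BS) 1?eq_sym //; apply/negP; apply: dis.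
have XB : X != B by apply: contraNneq aB => <-.
have bX : b \in X by rewrite -(eA _ XS XA).
have b'X : b' \notin X by rewrite -(eB _ XS XB).
have a'A : a' \notin A by rewrite (eB _ AS) //; apply/negP => /dis; apply.
split.
  case: (lS A X AS XS) => [sub|sub|E|E].
  - by apply/properP; split=> //; exists a.
  - by rewrite (fintype.subsetP sub) // in aA.
  - by have := finset.in_set0 b; rewrite -E inE bA bX.
  - by have := finset.in_setT a'; rewrite -E inE (negbTE a'A) (negbTE a'X).
case: (lS B X BS XS) => [sub|sub|E|E].
- by rewrite (fintype.subsetP sub) // in b'X.
- by rewrite (fintype.subsetP sub) // in aB.
- by rewrite finset.setIC.
- by have := finset.in_setT a'; rewrite -E inE (negbTE a'B) (negbTE a'X).
Qed.

Lemma disjoint_grow S A B a b a' b' : laminar S -> separating S -> A \in S -> B \in S ->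
  A :&: B = finset.set0 -> edge S A a b -> edge S B a' b' -> a != a' ->
  exists2 X, X \in S &
    (A \proper X /\ X :&: B = finset.set0) \/ (B \proper X /\ X :&: A = finset.set0).
Proof.
move=> lS sS AS BS AB eA eB /sS[X XS Xaa']; exists X => //.
have [aX|aX] := boolP (a \in X); [left|right].
  apply: (disjoint_grow_half lS AS BS XS AB eA eB) => //.
  by move: Xaa'; rewrite aX; case: (a' \in X).
apply: (disjoint_grow_half lS BS AS XS _ eB eA) => //; first by rewrite finset.setIC.
by move: Xaa'; rewrite (negbTE aX); case: (a' \in X).
Qed.

Definition setCs S : {set P} := [set ~: X | X in S]%SET.

Lemma mem_setCs S X : (X \in setCs S) = (~: X \in S).
Proof. by rewrite -{1}(finset.setCK X) mem_imset //; apply: finset.setC_inj. Qed.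

Lemma edge_setC S A a b : edge S A a b -> edge (setCs S) (~: A) b a.
Proof.
move=> [aA bA eA]; split; rewrite ?inE ?negbK // => X; rewrite mem_setCs => XS XA.
have := eA _ XS; rewrite !inE => H; apply: negb_inj; rewrite H //.
by apply: contraNneq XA => <-; rewrite finset.setCK.
Qed.

(** Complementation exchanges disjoint and covering pairs and reverses edges. *)
Lemma cover_shrink S A B a b a' b' : laminar S -> separating S -> A \in S -> B \in S ->
  A :|: B = [set: 'I_n]%SET -> edge S A a b -> edge S B a' b' -> b != b' ->
  exists2 X, X \in S &
    (X \proper A /\ X :|: B = [set: 'I_n]%SET) \/ (X \proper B /\ X :|: A = [set: 'I_n]%SET).
Proof.
move=> lS sS AS BS AB eA eB bb'.
have lS' : laminar (setCs S).
  move=> X Y; rewrite !mem_setCs => XS YS; case: (lS _ _ XS YS).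
  - by rewrite finset.setCS; constructor 2.
  - by rewrite finset.setCS; constructor 1.
  - by move/(congr1 (@finset.setC _)); rewrite finset.setCI !finset.setCK finset.setC0; constructor 4.
  - by move/(congr1 (@finset.setC _)); rewrite finset.setCU !finset.setCK finset.setCT; constructor 3.
have sS' : separating (setCs S).
  move=> i j /sS[X XS Hij]; exists (~: X); first by rewrite mem_setCs finset.setCK.
  by rewrite !inE; move: Hij; do 2!case: (_ \in X).
have AS' : ~: A \in setCs S by rewrite mem_setCs finset.setCK.
have BS' : ~: B \in setCs S by rewrite mem_setCs finset.setCK.
have AB' : ~: A :&: ~: B = finset.set0 by rewrite -finset.setCU AB finset.setCT.
have [X] := disjoint_grow lS' sS' AS' BS' AB' (edge_setC eA) (edge_setC eB) bb'.
rewrite mem_setCs => XS H; exists (~: X) => //.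
have E (Y : P) : X :&: ~: Y = finset.set0 -> ~: X :|: Y = [set: 'I_n]%SET.
  by move/(congr1 (@finset.setC _)); rewrite finset.setCI finset.setCK finset.setC0.
by case: H => [[XA /E]|[XB /E]]; [left|right]; split=> //; rewrite -properC finset.setCK.
Qed.
End LaminarFamilies.

Section StarSubdivision.
Variables (R : realType) (n : nat).
Local Notation P := {set 'I_n}.
Local Notation V := (spaceN R n).
Implicit Types (A B C X Y : P) (S T : {set P}) (i j : 'I_n) (lam mu : P -> R) (w : 'S_n).

(** The smallest face of the original complex whose cone contains the cone of
    the face [S] of the subdivision at [{A, B}] with new vertex [C]. *)
Definition star_preimage A B C S := if C \in S then (S :\ C) :|: [set A; B]%SET else S.

Definition star_complex (K : {set {set P}}) A B C : {set {set P}} :=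
  [set S : {set P} | ~~ ([set A; B]%SET \subset S) & star_preimage A B C S \in K]%SET.

Definition vertices (K : {set {set P}}) : {set P} := [set X : P | [set X]%SET \in K]%SET.

(** The field [se_sign] makes the wall introduced by the subdivision inside the
    cone of [S], where the coordinates of [vec A] and [vec B] agree, avoid the
    interior of every chamber: [u] is the difference of these coordinates. *)
Record star_edge (K : {set {set P}}) A B C : Prop := StarEdge {
  se_in : [set A; B]%SET \in K;
  se_neq : A != B;
  se_nontrivial : nontrivial C;
  se_sum : vec R C = vec R A + vec R B;
  se_sign : forall S w, S \in K -> A \in S -> B \in S -> chamber w `<=` @pcone R n S ->
    exists u : {scalar V}, [/\ u (vec R A) = 1, u (vec R B) = -1,
      forall X, X \in S -> X != A -> X != B -> u (vec R X) = 0
      & (forall x, chamber w x -> 0 <= u x) \/ (forall x, chamber w x -> u x <= 0)] }.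

Section Star.
Variables (K : {set {set P}}) (bK : braid_complex R K) (A B C : P) (sK : star_edge K A B C).

(** [vec C] already has the expansion [vec A + vec B]. *)
Lemma star_new S : S \in K -> C \notin S.
Proof.
move=> SK; apply/negP => CS; have nAB := negbTE (se_neq sK).
have := bc_uniq bK SK (se_in sK) (nonneg_on1 R CS)
  (nonneg_onD (nonneg_on1 R (set21 A B)) (nonneg_on1 R (set22 A B))).
rewrite combD !comb1 => /(_ (se_sum sK)) H.
have := H A; have := H B; rewrite !eqxx nAB [B == A]eq_sym nAB.
have [<-|_] := eqVneq B C; last by move=> /= *; exfalso; lra.
by rewrite nAB; move=> /= *; exfalso; lra.
Qed.

Lemma star_AC : A != C.
Proof. by apply: contraNneq (star_new (se_in sK)) => <-; rewrite set21. Qed.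

Lemma star_BC : B != C.
Proof. by apply: contraNneq (star_new (se_in sK)) => <-; rewrite set22. Qed.

(** Replaces [vec C] by [vec A + vec B] in a combination. *)
Definition fold_star lam X : R :=
  lam X + lam C * ((X == A)%:R + (X == B)%:R + (-1) * (X == C)%:R).

Lemma comb_fold_star lam : comb (fold_star lam) = comb lam.
Proof.
by rewrite combD combZ combD combD combZ !comb1 scaleN1r -(se_sum sK) subrr scaler0 addr0.
Qed.

Lemma fold_starC lam : fold_star lam C = 0.
Proof.
rewrite /fold_star eqxx ![C == _]eq_sym (negbTE star_AC) (negbTE star_BC) /=.
by ring.
Qed.

Lemma fold_starA lam : fold_star lam A = lam A + lam C.
Proof. by rewrite /fold_star eqxx (negbTE (se_neq sK)) (negbTE star_AC) /=; ring. Qed.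

Lemma fold_starB lam : fold_star lam B = lam B + lam C.
Proof. by rewrite /fold_star eqxx [B == A]eq_sym (negbTE (se_neq sK)) (negbTE star_BC) /=; ring. Qed.

Lemma fold_star_other lam X : X != A -> X != B -> X != C -> fold_star lam X = lam X.
Proof. by move=> /negbTE XA /negbTE XB /negbTE XC; rewrite /fold_star XA XB XC /=; ring. Qed.

Lemma fold_star_on S lam : nonneg_on S lam -> nonneg_on (star_preimage A B C S) (fold_star lam).
Proof.
move=> [l0 lS]; split=> X.
  have [->|XC] := eqVneq X C; first by rewrite fold_starC.
  have [->|XA] := eqVneq X A; first by rewrite fold_starA addr_ge0.
  have [->|XB] := eqVneq X B; first by rewrite fold_starB addr_ge0.
  by rewrite fold_star_other.
rewrite /star_preimage; case: ifPn => CS.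
  rewrite !inE !negb_or negb_and negbK => /and3P[XS XA XB].
  have [->|XC] := eqVneq X C; first by rewrite fold_starC.
  by rewrite fold_star_other // lS //; move: XS; rewrite (negbTE XC).
by move=> XS; rewrite /fold_star lS // (lS C) // mul0r addr0.
Qed.

Lemma star_preimage_sub S T : T \subset S -> star_preimage A B C T \subset star_preimage A B C S.
Proof.
move=> TS; rewrite /star_preimage; case: ifPn => CT.
  by rewrite (fintype.subsetP TS) // finset.setSU // finset.setSD.
case: ifPn => // _; apply: fintype.subset_trans (finset.subsetUl _ _).
by rewrite finset.subsetD1 TS.
Qed.

(** In a cone containing both [vec A] and [vec B], the half where the coordinate
    of [vec X] is at least that of [vec Y] is spanned once [vec Y] is replaced by
    [vec C]. *)
Lemma star_half S lam X Y : C \notin S -> X != Y -> X \in S -> Y \in S ->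
  vec R C = vec R X + vec R Y -> nonneg_on S lam -> lam Y <= lam X ->
  pcone (S :\ Y :|: [set C]%SET) (comb lam).
Proof.
move=> CS XY XS YS E [l0 lS] YX.
have XC : X != C by apply: contraNneq CS => <-.
have YC : Y != C by apply: contraNneq CS => <-.
exists (fun Z => lam Z + lam Y * ((Z == C)%:R + (-1) * ((Z == X)%:R + (Z == Y)%:R))); last first.
  by rewrite combD combZ combD combZ combD !comb1 scaleN1r E subrr scaler0 addr0.
split=> Z.
  have [->|ZC] := eqVneq Z C.
    rewrite lS // ![C == _]eq_sym (negbTE XC) (negbTE YC) /=.
    by have := l0 Y; lra.
  have [->|ZX] := eqVneq Z X; first by rewrite (negbTE XY) /=; lra.
  have [->|ZY] := eqVneq Z Y; first by rewrite /=; lra.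
  by have := l0 Z; rewrite /=; lra.
rewrite !inE negb_or negb_and negbK => /andP[ZS /negbTE ->].
have [->|ZY] := eqVneq Z Y; first by rewrite [Y == X]eq_sym (negbTE XY) /=; lra.
move: ZS; rewrite (negbTE ZY) => ZS.
have -> : Z == X = false by apply/negbTE; apply: contraNneq ZS => ->.
by rewrite lS //=; ring.
Qed.

Lemma star_half_in S X Y : S \in K -> [set A; B]%SET \subset S ->
  [set A; B]%SET = [set X; Y]%SET -> Y != C -> X \in S ->
  S :\ Y :|: [set C]%SET \in star_complex K A B C.
Proof.
move=> SK ABS E YC XS; rewrite inE; apply/andP; split.
  by apply/negP => /fintype.subsetP/(_ Y); rewrite E set22 !inE eqxx (negbTE YC) => /(_ isT).
rewrite /star_preimage !inE eqxx orbT; apply: (bc_down bK SK).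
apply/fintype.subsetP => Z; rewrite inE => /orP[|/(fintype.subsetP ABS) //].
by rewrite !inE; case: (Z == C); rewrite //= orbF => /andP[].
Qed.

(** Uniqueness is inherited through [fold_star]: two combinations with the same
    image have the same coefficient at [C], namely the minimum of the folded
    coefficients at [A] and [B], as [A] and [B] never occur together. *)
Lemma star_braid_complex : braid_complex R (star_complex K A B C).
Proof.
have AC := star_AC; have BC := star_BC; have AB := se_neq sK.
split.
- move=> S X; rewrite inE => /andP[_ SK] XS.
  have [->|XC] := eqVneq X C; first exact: se_nontrivial sK.
  apply: (bc_nontrivial bK SK); rewrite /star_preimage; case: ifP => // _.
  by rewrite !inE XC XS.
- move=> S T; rewrite !inE => /andP[ABS SK] TS; apply/andP; split.
    by apply: contraNN ABS => /fintype.subset_trans; apply.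
  exact: (bc_down bK SK (star_preimage_sub TS)).
- move=> S T lam mu; rewrite !inE => /andP[ABS SK] /andP[ABT TK] lS mT E.
  have H : fold_star lam =1 fold_star mu.
    by apply: (bc_uniq bK SK TK); rewrite ?comb_fold_star //; apply: fold_star_on.
  have zero (U : {set P}) (nu : P -> R) :
      ~~ ([set A; B]%SET \subset U) -> nonneg_on U nu -> nu A = 0 \/ nu B = 0.
    move=> ABU [_ nU]; have [AU|/nU] := boolP (A \in U); last by left.
    right; apply: nU; apply: contraNN ABU => BU; apply/fintype.subsetP => Z.
    by rewrite !inE => /orP[] /eqP ->.
  have HC : lam C = mu C.
    have := H A; have := H B; rewrite !fold_starA !fold_starB.
    have := lS.1 A; have := lS.1 B; have := mT.1 A; have := mT.1 B.
    have [->|->] := zero _ _ ABS lS; have [->|->] := zero _ _ ABT mT; lra.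
  move=> X; have [->//|XC] := eqVneq X C.
  by have := H X; rewrite /fold_star HC => /addIr.
- move=> w; have [S SK wS] := bc_cover bK w.
  have [ABS|ABS] := boolP ([set A; B]%SET \subset S); last first.
    by exists S => //; rewrite inE ABS /star_preimage (negbTE (star_new SK)).
  have AS : A \in S by rewrite (fintype.subsetP ABS) // set21.
  have BS : B \in S by rewrite (fintype.subsetP ABS) // set22.
  have CS := star_new SK.
  have [u [uA uB u0 usign]] := se_sign sK SK AS BS wS.
  have ul lam : nonneg_on S lam -> u (comb lam) = lam A - lam B.
    move=> [_ lS]; rewrite comb_lin (bigD1 A) //= (bigD1 B) 1?eq_sym //= big1.
      by rewrite uA uB; ring.
    move=> X /andP[XA XB]; have [XS|/lS ->] := boolP (X \in S); last by rewrite mul0r.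
    by rewrite u0 ?mulr0.
  case: usign => usign.
    exists (S :\ B :|: [set C]%SET); first exact: (@star_half_in S A B).
    move=> x xw; have [lam lS E] := wS x xw; rewrite E.
    apply: (star_half CS AB AS BS (se_sum sK) lS).
    by have := usign x xw; rewrite E ul // subr_ge0.
  exists (S :\ A :|: [set C]%SET); first by apply: (@star_half_in S B A) => //; rewrite finset.setUC.
  move=> x xw; have [lam lS E] := wS x xw; rewrite E.
  apply: (star_half CS _ BS AS _ lS); rewrite 1?eq_sym //; first by rewrite addrC (se_sum sK).
  by have := usign x xw; rewrite E ul // subr_le0.
Qed.

Lemma star_vertices : (#|vertices K| < #|vertices (star_complex K A B C)|)%N.
Proof.
have nAB X : ~~ ([set A; B]%SET \subset [set X]%SET).
  apply: contraNN (se_neq sK) => /fintype.subsetP H.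
  have := H A; have := H B; rewrite !inE !eqxx orbT => /(_ isT)/eqP -> /(_ isT)/eqP ->.
  by rewrite eqxx.
apply: fintype.proper_card; apply/properP; split.
  apply/fintype.subsetP => X; rewrite !inE nAB /star_preimage => XK.
  by rewrite (negbTE (star_new XK)).
exists C; rewrite !inE.
  rewrite nAB /star_preimage inE eqxx finset.setDv finset.set0U; exact: se_in sK.
by apply/negP => /star_new; rewrite inE eqxx.
Qed.
End Star.
End StarSubdivision.

(** * Choice of the two-dimensional cone to subdivide *)
Section StarEdgeExists.
Variables (R : realType) (n : nat).
Local Notation P := {set 'I_n}.
Local Notation V := (spaceN R n).
Implicit Types (A B C X Y : P) (S T : {set P}) (i j a b : 'I_n) (w : 'S_n).
Variables (K : {set {set P}}) (bK : braid_complex R K).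

Lemma full_laminar S : full R K S -> laminar S.
Proof. by move=> [SK _] A B AS BS; apply: (bc_laminar bK SK). Qed.

Lemma full_separating S : full R K S -> separating S.
Proof. by move=> fS i j; apply: full_separates fS. Qed.

Lemma pair_down S A B : S \in K -> A \in S -> B \in S -> [set A; B]%SET \in K.
Proof.
move=> SK AS BS; apply: (bc_down bK SK); apply/fintype.subsetP => X.
by rewrite !inE => /orP[] /eqP ->.
Qed.

(** A functional [dif i j] qualifies for [se_sign], since each chamber is on one
    side of each braid hyperplane. *)
Lemma star_edge_of_dif A B C : [set A; B]%SET \in K -> A != B -> vec R C = vec R A + vec R B ->
  (forall S, full R K S -> A \in S -> B \in S -> nontrivial C /\
     exists i j, [/\ dif i j (vec R A) = 1, dif i j (vec R B) = -1
       & forall X, X \in S -> X != A -> X != B -> dif i j (vec R X) = 0]) ->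
  star_edge R K A B C.
Proof.
move=> ABK AB CE H; split=> //.
  have [T fT /fintype.subsetP ABT] := full_above bK ABK.
  by have [] := H T fT (ABT _ (set21 A B)) (ABT _ (set22 A B)).
move=> S w SK AS BS wS; have [|_ [i [j [dA dB d0]]]] := H S _ AS BS; first by split=> //; exists w.
exists (dif i j : {scalar V}); split=> //.
exact: chamber_dif_sign.
Qed.

(** Maximality of the union forces the edges of [A] and [B] to start at the same
    vertex [a = a'], by [disjoint_grow]; the two dual coordinates then differ by
    [x_b - x_b']. *)
Lemma disjoint_star_edge A B : [set A; B]%SET \in K -> A :&: B = finset.set0 ->
  (forall X Y, [set X; Y]%SET \in K -> X :&: Y = finset.set0 ->
     (#|X :|: Y| <= #|A :|: B|)%N) ->
  star_edge R K A B (A :|: B).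
Proof.
move=> ABK AB0 Amax.
have dis x : x \in A -> (x \in B) = false.
  by move=> xA; have := finset.in_set0 x; rewrite -AB0 inE xA.
have AB : A != B.
  have /nontrivialP[i [j [iA jA]]] := bc_nontrivial bK ABK (set21 A B).
  by apply/eqP => AB; have := dis _ iA; rewrite -AB iA.
apply: star_edge_of_dif => //.
  apply: dif_inj => i j; rewrite linearD /= !dif_vec !inE.
  have := dis i; have := dis j.
  do 4!case: (_ \in _); move=> //= H1 H2; try lra;
    by [have := H1 isT | have := H2 isT].
move=> S fS AS BS; have [SK _] := fS.
have [a [b eA]] := full_edge bK fS AS; have [a' [b' eB]] := full_edge bK fS BS.
have aa' : a = a'.
  apply/eqP; apply: contraT.
  move/(disjoint_grow (full_laminar fS) (full_separating fS) AS BS AB0 eA eB).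
  move=> [X XS [[/properP[AX [x xX xA]] XB]|[/properP[BX [x xX xB]] XA]]].
    have := Amax X B (pair_down SK XS BS) XB; rewrite leqNgt; case/negP.
    apply: fintype.proper_card; apply/properP; split;
    first exact: finset.setSU.
    exists x; rewrite !inE ?xX // negb_or xA /=.
    by apply/negP => xB; have := finset.in_set0 x; rewrite -XB inE xX xB.
  have := Amax X A (pair_down SK XS AS) XA; rewrite leqNgt; case/negP.
  apply: fintype.proper_card; rewrite finset.setUC; apply/properP; split;
    first exact: finset.setSU.
  exists x; rewrite !inE ?xX // negb_or xB /=.
  by apply/negP => xA; have := finset.in_set0 x; rewrite -XA inE xX xA.
rewrite -{a'}aa' in eB; case: (eA) (eB) => [aA bA eA'] [aB b'B eB'].
split; first by apply/nontrivialP; exists b, a; rewrite !inE bA (negbTE aA) (negbTE aB).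
exists b, b'; rewrite !dif_vec bA b'B (dis _ bA).
have -> : b' \in A = false by apply: contraTF b'B => /dis ->.
split; [by rewrite subr0 | by rewrite sub0r|].
by move=> X XS XA XB; rewrite dif_vec -(eA' X) // -(eB' X) // subrr.
Qed.

(** Dual to [disjoint_star_edge]: here the edges end at the same vertex. *)
Lemma cover_star_edge A B : [set A; B]%SET \in K -> A :|: B = [set: 'I_n]%SET ->
  (forall X Y, [set X; Y]%SET \in K -> X :|: Y = [set: 'I_n]%SET ->
     (#|A :&: B| <= #|X :&: Y|)%N) ->
  star_edge R K A B (A :&: B).
Proof.
move=> ABK ABT Amin.
have cov x : x \notin A -> (x \in B).
  by move=> xA; have := finset.in_setT x; rewrite -ABT inE (negbTE xA).
have AB : A != B.
  have /nontrivialP[i [j [iA jA]]] := bc_nontrivial bK ABK (set21 A B).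
  by apply/eqP => AB; have := cov _ jA; rewrite -AB (negbTE jA).
apply: star_edge_of_dif => //.
  apply: dif_inj => i j; rewrite linearD /= !dif_vec !inE.
  have := cov i; have := cov j.
  do 4!case: (_ \in _); move=> //= H1 H2; try lra;
    by [have := H1 isT | have := H2 isT].
move=> S fS AS BS; have [SK _] := fS.
have [a [b eA]] := full_edge bK fS AS; have [a' [b' eB]] := full_edge bK fS BS.
have bb' : b = b'.
  apply/eqP; apply: contraT.
  move/(cover_shrink (full_laminar fS) (full_separating fS) AS BS ABT eA eB).
  move=> [X XS [[/properP[AX [x xX xA]] XB]|[/properP[BX [x xX xB]] XA]]].
    have := Amin X B (pair_down SK XS BS) XB; rewrite leqNgt; case/negP.
    apply: fintype.proper_card; apply/properP; split;
    first exact: finset.setSI.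
    exists x; rewrite !inE ?xX //= ?(negbTE xA) //.
    by have := finset.in_setT x; rewrite -XB inE (negbTE xA).
  have := Amin X A (pair_down SK XS AS) XA; rewrite leqNgt; case/negP.
  apply: fintype.proper_card; rewrite [A :&: B]finset.setIC; apply/properP; split;
    first exact: finset.setSI.
  exists x; rewrite !inE ?xX //= ?(negbTE xB) //.
  by have := finset.in_setT x; rewrite -XA inE (negbTE xB).
rewrite -{b'}bb' in eB; case: (eA) (eB) => [aA bA eA'] [a'B bB eB'].
have aB := cov _ aA.
have a'A : a' \in A by apply: contraT => /cov; rewrite (negbTE a'B).
split; first by apply/nontrivialP; exists b, a; rewrite !inE bA bB (negbTE aA).
exists a', a; rewrite !dif_vec a'A aB (negbTE aA) (negbTE a'B).
split; [by rewrite subr0 | by rewrite sub0r|].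
by move=> X XS XA XB; rewrite dif_vec (eA' X) // (eB' X) // subrr.
Qed.

Lemma star_edge_exists :
  (forall S A B, S \in K -> A \in S -> B \in S -> A \subset B \/ B \subset A) \/
  exists A B C, star_edge R K A B C.
Proof.
pose dis := [pred p : P * P | ([set p.1; p.2]%SET \in K) && (p.1 :&: p.2 == finset.set0)].
pose cov := [pred p : P * P | ([set p.1; p.2]%SET \in K) && (p.1 :|: p.2 == [set: 'I_n]%SET)].
case: (pickP dis) => [p0 disp0|nodis].
  right; case: (@arg_maxnP _ p0 dis (fun p => #|p.1 :|: p.2|) disp0) => -[A B].
  move=> /andP[/= ABK /eqP AB0] Amax; exists A, B, (A :|: B).
  apply: disjoint_star_edge => // X Y XYK XY0.
  by apply: (Amax (X, Y)); rewrite /= XYK XY0 eqxx.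
case: (pickP cov) => [p0 covp0|nocov].
  right; case: (@arg_minnP _ p0 cov (fun p => #|p.1 :&: p.2|) covp0) => -[A B].
  move=> /andP[/= ABK /eqP ABT] Amin; exists A, B, (A :&: B).
  apply: cover_star_edge => // X Y XYK XYT.
  by apply: (Amin (X, Y)); rewrite /= XYK XYT eqxx.
left=> S A B SK AS BS; have ABK := pair_down SK AS BS.
case: (bc_laminar bK SK AS BS); [by left | by right | |] => E.
  by have := nodis (A, B); rewrite /= ABK E eqxx.
by have := nocov (A, B); rewrite /= ABK E eqxx.
Qed.
End StarEdgeExists.

(** * The fan of a complex *)
Section FansOfComplexes.
Variables (R : realType) (n : nat).
Local Notation P := {set 'I_n}.
Local Notation V := (spaceN R n).
Implicit Types (A B C X Y : P) (S T : {set P}) (i j a b : 'I_n) (w : 'S_n).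

Definition fan_of (K : {set {set P}}) : set (set V) := [set pcone S | S in [set` K]].

Section Fan.
Variables (K : {set {set P}}) (bK : braid_complex R K).

Let nontriv S : S \in K -> forall A, A \in S -> nontrivial A.
Proof. by move=> SK A; apply: (bc_nontrivial bK SK). Qed.

Lemma gens_bc S : S \in K -> gens (@pcone R n S) = [set lat A | A in [set` S]].
Proof.
move=> SK; apply: gens_pcone; first exact: nontriv.
by move=> A AS; apply: (indep_exposed (bc_indep bK SK)).
Qed.

Lemma pcone_subset_bc S T : S \in K -> T \in K -> pcone S `<=` @pcone R n T -> S \subset T.
Proof.
move=> SK TK ST; apply/fintype.subsetP => A AS; apply: contraT => AT.
have [lam lT Hl] := ST _ (pcone_vec R AS).
have := bc_uniq bK TK SK lT (nonneg_on1 R AS); rewrite comb1 => /(_ (esym Hl) A).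
by rewrite (lT.2 _ AT) eqxx => /esym/eqP; rewrite oner_eq0.
Qed.

Lemma pconeI_bc S T : S \in K -> T \in K -> pcone S `&` pcone T = @pcone R n (S :&: T).
Proof.
move=> SK TK; apply/seteqP; split=> x; last first.
  by move=> HI; split; apply: pcone_sub HI; [apply: finset.subsetIl | apply: finset.subsetIr].
move=> [[l lS ->] [m mT Hlm]]; have E := bc_uniq bK SK TK lS mT Hlm.
exists l => //; split=> [|A]; first exact: lS.1.
by rewrite inE negb_and => /orP[/(lS.2 A)|/(mT.2 A)] //; rewrite E.
Qed.

Lemma fan_of_is_fan : is_fan (fan_of K).
Proof.
split.
- exact: finite_image.
- move=> _ [S SK <-]; split.
    exists [set lat A | A in [set` S]]; first exact: finite_image.
    by rewrite cone_lat //; apply: nontriv.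
  move=> x [l lS ->] [m mS Hm].
  have E : comb (fun A => l A + m A) = comb (fun=> 0).
    rewrite combD -Hm subrr [RHS]big1 // => A _; exact: scale0r.
  rewrite /comb big1 // => A _.
  have := indep_inj (bc_indep bK SK) (nonneg_onD lS mS).2 (fun _ _ => erefl) E A.
  by move/eqP; rewrite paddr_eq0 ?lS.1 ?mS.1 // => /andP[/eqP -> _]; rewrite scale0r.
- move=> _ tau [S SK <-] /face_sub_pcone[S' SS ->].
  by exists S' => //; apply: (bc_down bK SK SS).
- move=> _ _ [S SK <-] [T TK <-]; rewrite pconeI_bc //.
  by split; apply: pcone_sub_face;
    [exact: (bc_indep bK SK)|exact: finset.subsetIl|
     exact: (bc_indep bK TK)|exact: finset.subsetIr].
Qed.

Lemma fan_of_smooth : smooth_fan (fan_of K).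
Proof.
split; first exact: fan_of_is_fan.
move=> _ [S SK <-]; have [T fT ST] := full_above bK SK.
have [b bZ Tb] := full_Zbasis bK fT; exists b => // v.
rewrite gens_bc // => -[A /= AS <-].
exact/Tb/(fintype.subsetP ST).
Qed.

Section Star.
Variables (A B C : P) (sK : star_edge R K A B C).
Let tau := @pcone R n [set A; B]%SET.

Lemma star_lat : \sum_(v \in gens tau) v = lat C.
Proof.
have ABK := se_in sK; have AB := se_neq sK; rewrite gens_bc //.
have inj : set_inj [set` [set A; B]%SET] (@lat n).
  by move=> X Y /set_mem /= XS /set_mem /= YS; apply: lat_inj; apply: (nontriv ABK).
rewrite fsbig_image //.
have -> : [set` [set A; B]%SET] = [set` [:: A; B]].
  by apply/seteqP; split=> X /=; rewrite !inE.
rewrite -fsbig_seq /= ?inE ?AB // big_cons big_seq1.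
by apply: (@toNR_inj R); rewrite toNRD !toNR_lat (se_sum sK).
Qed.

(** A cone of the subdivision inside [pcone S] is generated by the image under
    [lat] of some [S'] contained in [S :|: [set C]], and its [star_preimage] is
    contained in [S].  Conversely, a new face [S'] containing [C] arises in this
    way from [S = star_preimage A B C S']. *)
Lemma fan_of_star : star_subdivision (fan_of K) tau = fan_of (star_complex K A B C).
Proof.
have ABK := se_in sK.
have sbK := star_braid_complex bK sK.
have lat_set (S : {set P}) (D : set (latN n)) : D `<=` [set lat X | X in [set` S]] ->
    exists2 S' : {set P}, S' \subset S & D = [set lat X | X in [set` S']].
  move=> DS; exists [set X in S | `[< D (lat X) >]]%SET.
    by apply/fintype.subsetP => X; rewrite inE => /andP[].
  apply/seteqP; split=> v; last by move=> [X /=]; rewrite inE => /andP[_ /asboolP ?] <-.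
  by move=> Dv; have [X /= XS E] := DS v Dv;
    exists X => //=; rewrite inE XS; apply/asboolP; rewrite E.
have lat_sub (S T : {set P}) :
    (forall X, X \in S -> nontrivial X) -> (forall X, X \in T -> nontrivial X) ->
    [set lat X | X in [set` S]] `<=` [set lat X | X in [set` T]] -> S \subset T.
  move=> pS pT ST; apply/fintype.subsetP => X XS.
  have [|Y /= YT] := ST (lat X); first by exists X.
  by move/(lat_inj (pT _ YT) (pS _ XS)) => <-.
apply/seteqP; split=> sigma.
- case=> [[[S SK <-] nS]|[_ [[S SK <-] tS]]].
    exists S => //=; rewrite inE /star_preimage (negbTE (star_new bK sK SK)) SK andbT.
    by apply/negP => ABS; apply: nS; apply: pcone_sub.
  have ABS := pcone_subset_bc ABK SK tS.
  case=> D [DS nD] <-; rewrite gens_bc // star_lat in DS.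
  have [|S' SS E] := lat_set (S :|: [set C]%SET) D.
    move=> v /DS[[X /= XS <-]|->]; first by exists X; rewrite //= inE XS.
    by exists C; rewrite //= !inE eqxx orbT.
  have S'K : S' \in star_complex K A B C.
    rewrite inE; apply/andP; split.
      apply/negP => ABS'; apply: nD; rewrite gens_bc // E => v [X /= XAB <-].
      by exists X => //=; apply: (fintype.subsetP ABS').
    apply: (bc_down bK SK); apply/fintype.subsetP => X; rewrite /star_preimage.
    case: ifPn => CS'.
      rewrite !inE => /orP[/andP[XC /(fintype.subsetP SS)]|XAB].
        by rewrite !inE (negbTE XC) orbF.
      by apply: (fintype.subsetP ABS); rewrite !inE.
    move=> XS'; have := fintype.subsetP SS _ XS'; rewrite !inE => /orP[//|/eqP XC].
    by rewrite XC (negbTE CS') in XS'.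
  exists S' => //; rewrite E cone_lat // => X; exact: (bc_nontrivial sbK S'K).
- move=> [S SK <-]; have := SK; rewrite /= inE => /andP[ABS SpreK].
  have [CS|CS] := boolP (C \in S); last first.
    rewrite /star_preimage (negbTE CS) in SpreK; left; split; first by exists S.
    by move/(pcone_subset_bc ABK SpreK); rewrite (negbTE ABS).
  right; rewrite /star_preimage CS in SpreK; exists (pcone (S :\ C :|: [set A; B]%SET)).
    split; first by eexists; last by []; exact: SpreK.
    exact/pcone_sub/finset.subsetUr.
  exists [set lat X | X in [set` S]]; last first.
    by rewrite cone_lat // => X; apply: (bc_nontrivial sbK SK).
  rewrite star_lat !gens_bc //; split.
    move=> v [X /= XS <-]; have [->|XC] := eqVneq X C; first by right.
    by left; exists X; rewrite //= !inE XC XS.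
  move/lat_sub => H; case/negP: ABS; apply: H; first exact: nontriv.
  by move=> X; apply: (bc_nontrivial sbK SK).
Qed.

Lemma fan_of_star_subdivision :
  obtained_by_star_subdivision (fan_of K) (fan_of (star_complex K A B C)).
Proof.
split; first exact: fan_of_smooth.
have ABK := se_in sK; exists tau; split; [by exists [set A; B]%SET | | by rewrite fan_of_star].
move=> E; have : tau (vec R A) by apply/pcone_vec/set21.
by rewrite E /= => /eqP; apply/negP/vec_neq0/(nontriv ABK)/set21.
Qed.
End Star.

(** An order sorting the sum of [vec A] over a chain [S] makes each [A] in [S] an
    upper set, so [pcone S] lies in one chamber; if it also contains a chamber,
    the two are equal. *)
Lemma fan_of_chains :
  (forall S A B, S \in K -> A \in S -> B \in S -> A \subset B \/ B \subset A) ->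
  fan_of K = braid_fan R n.
Proof.
move=> chain.
have eq_ch S w : S \in K -> chamber w `<=` @pcone R n S -> pcone S = @chamber R n w.
  move=> SK wS; suff [w' Sw'] : exists w', @pcone R n S `<=` chamber w'.
    have E := chamber_rank_pt_eq (Sw' _ (wS _ (chamber_rank_pt R w))).
    by apply/seteqP; split=> // x /Sw'; rewrite E.
  pose x := \sum_(A in S) vec R A.
  have [w' wx] := chamber_cover x; exists w'.
  apply: pcone_min; [exact: chamber0|exact: chamberD|exact: chamberZ|].
  move=> A AS; apply/chamber_vec => i j ij iA; apply: contraT => jA.
  have := (chamberP w' x).1 wx i j ij.
  rewrite linear_sum leNgt; case/negP; rewrite (bigD1 A) //= dif_vec iA (negbTE jA) sub0r.
  rewrite addrC subr_lt0; apply: le_lt_trans (ltr01); apply: sumr_le0 => B /andP[BS BA].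
  rewrite dif_vec subr_le0 ler_nat.
  have [jB|//] := boolP (w' j \in B).
  have [/fintype.subsetP/(_ _ iA) ->//|/fintype.subsetP/(_ _ jB)] := chain S A B SK AS BS.
  by rewrite (negbTE jA).
apply/seteqP; split=> tau.
  move=> [S SK <-]; have [T [TK [w wT]] ST] := full_above bK SK.
  by exists w; rewrite -(eq_ch T w) //; apply: (pcone_sub_face (bc_indep bK TK)).
move=> [w]; have [S SK wS] := bc_cover bK w; rewrite -(eq_ch S w) //.
move=> /face_sub_pcone[S' SS ->]; exists S' => //; exact: (bc_down bK SK).
Qed.
End Fan.

(** Star subdivisions at two-element faces raise the number of rays, for which
    there are finitely many candidates. *)
Lemma subdivide_to_braid_fan K : braid_complex R K ->
  exists (l : nat) (Sigmas : nat -> set (set V)),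
    [/\ Sigmas 0%N = fan_of K, Sigmas l = braid_fan R n,
        forall i : nat, (i <= l)%N -> is_fan (Sigmas i)
      & forall i : nat, (1 <= i <= l)%N ->
          obtained_by_star_subdivision (Sigmas i.-1) (Sigmas i)].
Proof.
have [m] := ubnP (#|{: P}| - #|vertices K|).
elim: m K => // m IH K Km bK.
have [chain|[A [B [C sK]]]] := star_edge_exists bK.
  exists 0%N, (fun=> fan_of K); split=> //; first exact: fan_of_chains.
    by move=> i _; apply: fan_of_is_fan.
  by case.
have [||l [Sigmas [S0 Sl Sfan Sstar]]] := IH (star_complex K A B C).
- have vlt := star_vertices bK sK.
  have vle : (#|vertices (star_complex K A B C)| <= #|{: P}|)%N by apply: max_card.
  by rewrite -ltnS; apply: leq_trans Km; rewrite ltnS ltn_sub2l // (leq_trans vlt).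
- exact: star_braid_complex.
exists l.+1, (fun i : nat => if i is i'.+1 then Sigmas i' else fan_of K); split=> //.
  by case=> [_|i /Sfan //]; apply: fan_of_is_fan.
case=> // -[_|i /= il]; last exact: (Sstar i.+1).
by rewrite /= S0; apply: fan_of_star_subdivision.
Qed.
End FansOfComplexes.

(** * Theorem of the alternative *)
Section Gordan.
Variables (R : realType) (n : nat) (T : eqType) (f : T -> 'rV[R]_n).
Implicit Types (G : seq T) (u : 'cV[R]_n) (c : T -> R).

Let ev u g := (f g *m u) 0 0.

Lemma large_multiple G (a b : T -> R) : (forall g, g \in G -> 0 < a g) ->
  exists2 N, 0 <= N & forall g, g \in G -> 0 < N * a g + b g.
Proof.
elim: G => [|g G IH] aG; first by exists 0.
have [h hG|N N0 HN] := IH; first by rewrite aG // inE hG orbT.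
have ag := aG g (mem_head _ _).
have M0 : 0 <= `|b g| / a g by rewrite divr_ge0 // ltW.
exists (N + (1 + `|b g| / a g)) => [|h]; first by rewrite !addr_ge0.
rewrite inE => /predU1P[->|hG]; rewrite mulrDl.
  rewrite mulrDl mul1r divfK ?gt_eqF //.
  have := ler_norm (- b g); rewrite normrN; have := mulr_ge0 N0 (ltW ag); lra.
have := HN h hG; have : 0 <= (1 + `|b g| / a g) * a h.
  by rewrite mulr_ge0 ?addr_ge0 // ltW // aG // inE hG orbT.
lra.
Qed.

(** Gordan's theorem modulo the row space of [L], by induction on [G].  If [u]
    solves the problem for [G] but is not positive on [g], it is either replaced
    by a solution that vanishes on [g], tilted slightly to become positive there,
    or a dependency modulo [g] exists; evaluating [u] on it shows that [g] enters
    with a sign that makes it a dependency of [g :: G]. *)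
Lemma gordan m (L : 'M[R]_(m, n)) G : uniq G ->
  (exists u, L *m u = 0 /\ forall g, g \in G -> 0 < ev u g) \/
  (exists c, [/\ forall g, 0 <= c g, exists2 g, g \in G & 0 < c g
     & ((\sum_(g <- G) c g *: f g)%R <= L)%MS]).
Proof.
elim: G m L => [|g G IH] m L; first by left; exists 0; rewrite mulmx0.
move=> /= /andP[gG uG].
have sum_upd c t : \sum_(h <- G) (if h == g then t else c h) *: f h = \sum_(h <- G) c h *: f h.
  by apply: eq_big_seq => h hG; case: eqP => // E; rewrite -E hG in gG.
have [[u [Lu uG0]]|[c [c0 [h hG ch] cL]]] := IH m L uG; last first.
  right; exists (fun h => if h == g then 0 else c h); split.
  - by move=> k; case: ifP.
  - exists h; first by rewrite inE hG orbT.
    by case: eqP => // E; rewrite -E hG in gG.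
  - by rewrite big_cons eqxx scale0r add0r sum_upd.
have [ug|ug] := ltP 0 (ev u g).
  by left; exists u; split=> // h; rewrite inE => /predU1P[->|/uG0].
have [gL|gL] := boolP (f g <= L)%MS.
  right; exists (fun h => (h == g)%:R); split=> [h||]; first exact: ler0n.
    by exists g; rewrite ?mem_head // eqxx ltr01.
  rewrite big_cons eqxx scale1r big_seq big1 ?addr0 // => h hG.
  by case: eqP => [E|]; [rewrite -E hG in gG | rewrite scale0r].
have [[u' [gLu uG']]|[c [c0 [h hG ch] /submxP[D cD]]]] := IH _ (col_mx (f g) L) uG.
- have [w [Lw gw]] : exists w, L *m w = 0 /\ 0 < ev w g.
    have [j Hj] : exists j, (f g *m cokermx L) 0 j != 0.
      apply: contrapT => H; case/negP: gL; rewrite submxE; apply/eqP/matrixP => i j.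
      rewrite (ord1 i) [RHS]mxE; apply/eqP; apply: contrapT => /negP Hj.
      by apply: H; exists j.
    have Lw : L *m col j (cokermx L) = 0 by rewrite colE mulmxA mulmx_coker mul0mx.
    have gw : (f g *m col j (cokermx L)) 0 0 = (f g *m cokermx L) 0 j.
      by rewrite colE mulmxA -colE mxE.
    exists ((f g *m cokermx L) 0 j *: col j (cokermx L)).
    split; first by rewrite -scalemxAr Lw scaler0.
    by rewrite /ev -scalemxAr mxE gw -expr2 exprn_even_gt0.
  have [N N0 HN] := large_multiple (ev w) uG'.
  move: gLu; rewrite mul_col_mx => H.
  have [gu Lu'] : f g *m u' = 0 /\ L *m u' = 0.
    by apply/eq_col_mx; rewrite H col_mx0.
  left; exists (N *: u' + w); split.
    by rewrite mulmxDr -scalemxAr Lu' scaler0 Lw addr0.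
  have E k : ev (N *: u' + w) k = N * ev u' k + ev w k.
    by rewrite /ev mulmxDr -scalemxAr mxE [X in X + _]mxE.
  move=> k; rewrite E inE => /predU1P[->|/HN //].
  by rewrite /ev gu mxE mulr0 add0r.
right; rewrite -[D]hsubmxK mul_row_col in cD.
set t := lsubmx D in cD.
have tg : t *m f g = t 0 0 *: f g by rewrite {1}[t]mx11_scalar mul_scalar_mx.
have t0 : t 0 0 < 0.
  have Hu : 0 < t 0 0 * ev u g.
    have <- : \sum_(k <- G) c k * ev u k = t 0 0 * ev u g.
      have := congr1 (fun x => (x *m u) 0 0) cD.
      rewrite /= tg mulmxDl -scalemxAl -mulmxA Lu mulmx0 addr0 [RHS]mxE => <-.
      by rewrite mulmx_suml summxE; apply: eq_bigr => k _; rewrite -scalemxAl mxE.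
    rewrite (big_rem h) //= ltr_pwDl ?mulr_gt0 ?uG0 //.
    rewrite big_seq; apply: sumr_ge0 => k /mem_rem kG.
    by rewrite mulr_ge0 // ltW // uG0.
  rewrite ltNge; apply/negP => t0; move: Hu; rewrite ltNge => /negP; apply.
  exact: mulr_ge0_le0.
exists (fun k => if k == g then - t 0 0 else c k); split.
- by move=> k; case: ifP => // _; rewrite oppr_ge0 ltW.
- exists h; first by rewrite inE hG orbT.
  by case: eqP => // E; rewrite -E hG in gG.
- rewrite big_cons eqxx sum_upd cD tg addrA scaleNr addNr add0r.
  exact: submxMl.
Qed.
End Gordan.

(** * Smooth fans refined by the braid fan *)
Section SmoothFans.
Variables (R : realType) (n : nat).
Local Notation P := {set 'I_n}.
Local Notation V := (spaceN R n).
Implicit Types (A B C X Y : P) (S T : {set P}) (w : 'S_n).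

Lemma cone_closed (D : set (latN n)) : finite_set D ->
  [/\ cone D (0 : V), forall x y : V, cone D x -> cone D y -> cone D (x + y)
    & forall c (x : V), 0 <= c -> cone D x -> cone D (c *: x)].
Proof.
move=> fD; have [s E] : exists s : seq (latN n), forall l : latN n -> R,
    \sum_(v \in D) l v *: toNR R v = \sum_(v <- s) l v *: toNR R v.
  by eexists=> l; exact: fsbig_finite.
split.
- exists (fun=> 0) => //; rewrite E big1 // => v _; exact: scale0r.
- move=> x y [l l0 ->] [m m0 ->]; exists (fun v => l v + m v).
    by move=> v Dv; rewrite addr_ge0 ?l0 ?m0.
  by rewrite !E -big_split; apply: eq_bigr => v _; rewrite scalerDl.
- move=> c x c0 [l l0 ->]; exists (fun v => c * l v).
    by move=> v Dv; rewrite mulr_ge0 ?l0.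
  by rewrite !E scaler_sumr; apply: eq_bigr => v _; rewrite scalerA.
Qed.

(** A functional that vanishes on [vec A] and is positive on the other generators
    is sought.  By [gordan] the obstruction is a positive combination of these
    equal to [t *: vec A]; for [t > 0] the generator [A] would be redundant, and
    for [t <= 0] the cone would contain a line. *)
Lemma irredundant_exposed S A : (forall B, B \in S -> nontrivial B) ->
  strongly_convex (@pcone R n S) -> A \in S -> ~ pcone (S :\ A) (vec R A) -> exposed R S A.
Proof.
move=> pS sS AS nA; pose ind B : 'rV[R]_n := \row_i (i \in B)%:R.
have [[u [Lu uG]]|[c [c0 [B0 B0G cB0] cL]]] :=
  gordan ind (col_mx (const_mx 1 : 'rV_n) (ind A)) (enum_uniq (mem (S :\ A)%SET)).
  move: Lu; rewrite mul_col_mx => H.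
  have [u1 uA] : const_mx 1 *m u = 0 :> 'M_1 /\ ind A *m u = 0.
    by apply/eq_col_mx; rewrite H col_mx0.
  have [f Hf] := lfun_scalar u1; exists f; first by rewrite Hf lfun_pi // uA mxE.
  by move=> B BS BA; rewrite Hf lfun_pi // uG // mem_enum in_setD1 BA.
exfalso; rewrite big_enum /= in cL; rewrite mem_enum in B0G.
have [D cD] := submxP cL; rewrite -[D]hsubmxK mul_row_col in cD.
have {cD} [t cD] : exists t, \sum_(B in S :\ A) c B *: vec R B = t *: vec R A.
  exists (rsubmx D 0 0); apply: dif_inj => i j.
  have -> : \sum_(B in S :\ A) c B *: vec R B = \pi_V (\sum_(B in S :\ A) c B *: ind B).
    elim/big_ind2: _ => [|y y' z z' -> ->|k _]; rewrite ?pi_onesD ?pi_onesZ //.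
    by rewrite -[RHS]/(\pi_V 0) pi_quot_zero.
  rewrite cD dif_pi linearZ /= dif_pi !mxE !big_ord1 !mxE; ring.
have inS X : X \in (S :\ A)%SET -> X \in S by rewrite in_setD1 => /andP[].
have sum_in (Q : pred P) : pcone (S :\ A) (\sum_(B in S :\ A | Q B) c B *: vec R B).
  apply: (big_ind (pcone (S :\ A))); [exact: pcone0|exact: pconeD|].
  by move=> B /andP[BS _]; apply: pconeZ => //; apply: pcone_vec.
have SAS : (S :\ A)%SET \subset S by apply: finset.subsetDl.
have tot : pcone (S :\ A) (t *: vec R A).
  by have := sum_in predT; rewrite -cD; congr pcone; apply: eq_bigl => B; rewrite andbT.
have [t_gt0|t_le0] := ltP 0 t.
  apply: nA; rewrite -[vec R A]scale1r -(mulVf (lt0r_neq0 t_gt0)) -scalerA.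
  by apply: pconeZ => //; rewrite invr_ge0 ltW.
have tA : t *: vec R A = 0.
  apply: sS; first exact: pcone_sub tot.
  by rewrite -scaleNr; apply: pconeZ; [rewrite oppr_ge0 | apply: pcone_vec].
have cB : c B0 *: vec R B0 = 0.
  apply: sS; first by apply: pconeZ => //; apply/pcone_vec/inS.
  have -> : - (c B0 *: vec R B0) = \sum_(B in S :\ A | B != B0) c B *: vec R B.
    by have := tA; rewrite -cD (bigD1 B0) //= => /eqP; rewrite addrC addr_eq0 => /eqP ->.
  exact: (pcone_sub SAS (sum_in _)).
move/eqP: cB; rewrite scaler_eq0 gt_eqF //=; exact/negP/vec_neq0/pS/inS.
Qed.

(** The coordinate of [v] in a basis of the lattice extends to the real space
    by prescribing its values on the standard basis. *)
Lemma Zbasis_dual (b : seq (latN n)) v : is_Zbasis b -> v \in b ->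
  exists u : {scalar V}, u (toNR R v) = 1 /\
    forall v', v' \in b -> v' != v -> u (toNR R v') = 0.
Proof.
move=> bZ vb.
have /choice[c Hc] : forall x : latN n, exists c : {ffun 'I_(size b) -> int},
    x = \sum_(i < size b) c i *: b`_i by move=> x; have [c [Hc _]] := bZ x; exists c.
have cU x (d : {ffun 'I_(size b) -> int}) : x = \sum_(i < size b) d i *: b`_i -> c x = d.
  by move=> Hd; have [e [_ eU]] := bZ x; rewrite -(eU _ Hd) -(eU _ (Hc x)).
have lin k : linear_for *%R (fun x => c x k).
  move=> a x y; rewrite (cU _ [ffun i => a * c x i + c y i]); first by rewrite ffunE.
  rewrite {1}(Hc x) {1}(Hc y) scaler_sumr -big_split; apply: eq_bigr => i _.
  by rewrite ffunE scalerDl scalerA.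
have cb (i k : 'I_(size b)) : c b`_i k = (i == k)%:R.
  rewrite (cU _ [ffun j => (i == j)%:R]) ?ffunE //.
  rewrite (bigD1 i) //= ffunE eqxx scale1r big1 ?addr0 // => j ji.
  by rewrite ffunE eq_sym (negbTE ji) scale0r.
have kb : (index v b < size b)%N by rewrite index_mem.
pose k := Ordinal kb.
pose m := GRing.isLinear.Build int (latN n) int *%R (fun x => c x k) (lin k).
pose ck : {scalar latN n} := HB.pack_for {scalar latN n} (fun x => c x k) m.
pose e i : 'rV[int]_n := delta_mx 0 i.
have ckE (z : 'rV[int]_n) : ck (\pi_(latN n) z) = \sum_i z 0 i * ck (\pi_(latN n) (e i)).
  rewrite {1}(row_sum_delta z).
  have -> : \pi_(latN n) (\sum_i z 0 i *: e i) = \sum_i z 0 i *: \pi_(latN n) (e i).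
    elim/big_ind2: _ => [|y y' t t' <- <-|i _]; rewrite ?pi_onesD ?pi_onesZ //.
    by rewrite -[LHS]/(\pi_(latN n) 0) pi_quot_zero.
  by rewrite linear_sum; apply: eq_bigr => i _; rewrite linearZ.
pose U : 'cV[R]_n := \col_i (ck (\pi_(latN n) (e i)))%:~R.
have intE (z : 'rV[int]_n) : (map_mx intr z *m U) 0 0 = (ck (\pi_(latN n) z))%:~R.
  rewrite ckE rmorph_sum mxE; apply: eq_bigr => i _; by rewrite !mxE rmorphM.
have U1 : const_mx 1 *m U = 0 :> 'M_1.
  apply/matrixP=> x y; rewrite !ord1.
  have -> : (const_mx 1 : 'rV[R]_n) = map_mx intr (const_mx 1 : 'rV[int]_n).
    by rewrite map_const_mx rmorph1.
  rewrite intE mxE; have -> : \pi_(latN n) (const_mx 1) = 0 :> latN n; last by rewrite linear0.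
  rewrite -[RHS](pi_quot_zero int n); apply/eqP/quot_onesP; exists 1.
  by rewrite subr0 scale1r.
have [f Hf] := lfun_scalar U1; exists f.
have fE x : f (toNR R x) = (c x k)%:~R.
  by elim/quotW: x => z; rewrite toNR_pi Hf lfun_pi // intE.
have cE x : x \in b -> c x k = (x == v)%:R.
  move=> xb; have ib : (index x b < size b)%N by rewrite index_mem.
  have := cb (Ordinal ib) k; rewrite -val_eqE /= nth_index // => ->; congr (nat_of_bool _)%:R.
  apply/eqP/eqP => [E|-> //].
  by rewrite -(nth_index 0 xb) E nth_index.
split; first by rewrite fE cE // eqxx.
by move=> x xb /negbTE xv; rewrite fE cE // xv.
Qed.

Section Fan.
Variables (Sigma : set (set V)) (smS : smooth_fan Sigma).
Variable refS : refined_by Sigma (braid_fan R n).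

Lemma chamber_in_fan w : exists2 sigma, Sigma sigma & chamber w `<=` sigma.
Proof.
apply: refS; exists w; have [|f Hf] := @scalar_pack R n (fun=> 0).
  by move=> a x y; rewrite mulr0 addr0.
exists f; first by move=> x _; rewrite Hf.
by apply/seteqP; split=> x; [split | case].
Qed.

(** Expand a point of [sigma] along a chamber containing it: the cone over the
    chamber meets [sigma] in a face, which contains every summand. *)
Lemma fan_cone_generated sigma : Sigma sigma ->
  sigma = pcone [set A | nontrivial A && `[< sigma (vec R A) >]]%SET.
Proof.
move=> Ss; have [[_ poly _ inter] _] := smS.
have [[D fD sD] _] := poly _ Ss; have [c0 cD cZ] := cone_closed fD.
apply/seteqP; split=> x; last first.
  rewrite {2}sD; apply: pcone_min; [exact: c0|exact: cD|exact: cZ|].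
  by move=> A; rewrite inE -sD => /andP[_ /asboolP].
move=> sx; have [w wx] := chamber_cover x.
have [sigma' Ss' ws'] := chamber_in_fan w.
have [_ [u u0 Eu]] := inter _ _ Ss Ss'.
have ux : u x = 0.
  have : (sigma `&` sigma') x by split=> //; apply: ws'.
  by rewrite Eu => -[].
have := wx; rewrite chamber_pcone => -[l lw xl]; exists l => //.
split=> [|A]; first exact: lw.1.
rewrite inE; have [/(@flagP R)[pA wA]|/lw.2 //] := boolP (A \in flag w).
rewrite pA /= => /asboolP nA; apply: (@nonneg_on_pcone0 R n _ _ u lw).
- by move=> B /(@flagP R)[_ wB]; apply/u0/ws'.
- by rewrite -xl.
- apply/eqP => uA; apply: nA.
  have : [set y | sigma' y /\ u y = 0] (vec R A) by split=> //; apply: ws'.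
  by rewrite -Eu => -[].
Qed.

(** By [irredundant_exposed] an irredundant subset of the generators consists of
    ray generators, which smoothness makes part of a basis of the lattice. *)
Lemma fan_cone_simplicial sigma : Sigma sigma ->
  exists S, [/\ sigma = pcone S, forall A, A \in S -> nontrivial A & indep R S].
Proof.
move=> Ss; have [[_ poly _ _] sm] := smS.
have [_ sc] := poly _ Ss; have [b bZ gb] := sm _ Ss.
pose gen S := [forall A in S, nontrivial A] && `[< sigma = pcone S >].
have gen0 : gen [set A | nontrivial A && `[< sigma (vec R A) >]]%SET.
  apply/andP; split; last exact/asboolP/fan_cone_generated.
  by apply/forall_inP => A; rewrite inE => /andP[].
case: (@arg_minnP _ _ gen (fun S => #|S|) gen0) => S /andP[/forall_inP pS /asboolP sS] Smin.
have eS A : A \in S -> exposed R S A.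
  move=> AS; apply: irredundant_exposed => //; first by rewrite -sS.
  move=> HA; have := Smin (S :\ A)%SET; rewrite [#|S|](cardsD1 A) AS add1n ltnn.
  move=> H; have /H // : gen (S :\ A)%SET.
  apply/andP; split.
    by apply/forall_inP => B; rewrite in_setD1 => /andP[_ /pS].
  apply/asboolP; rewrite sS; apply/seteqP; split; last by apply/pcone_sub/finset.subsetDl.
  apply: pcone_min; [exact: pcone0|exact: pconeD|exact: pconeZ|].
  move=> B BS; have [->//|BA] := eqVneq B A.
  by apply: pcone_vec; rewrite in_setD1 BA.
exists S; split=> // A AS.
have lb B : B \in S -> lat B \in b.
  by move=> BS; apply: gb; rewrite sS gens_pcone //; exists B.
have [u [uA ub]] := Zbasis_dual bZ (lb A AS).
exists u; first by rewrite -toNR_lat.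
move=> B BS BA; rewrite -toNR_lat ub ?lb //.
by apply: contra_neq BA; apply: lat_inj; apply: pS.
Qed.

Definition complex_of : {set {set P}} :=
  [set S | [&& `[< Sigma (pcone S) >], [forall A in S, nontrivial A] & `[< indep R S >]]]%SET.

Lemma complex_ofP S : reflect [/\ Sigma (pcone S), forall A, A \in S -> nontrivial A & indep R S]
  (S \in complex_of).
Proof.
rewrite inE; apply: (iffP and3P) => -[].
  by move=> /asboolP ? /forall_inP ? /asboolP.
by move=> *; split; [apply/asboolP|apply/forall_inP|apply/asboolP].
Qed.

Lemma fan_of_complex_of : fan_of complex_of = Sigma.
Proof.
apply/seteqP; split=> sigma; first by move=> [S /complex_ofP[? _ _] <-].
move=> Ss; have [S [E pS iS]] := fan_cone_simplicial Ss.
by exists S => //; apply/complex_ofP; split; rewrite -?E.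
Qed.

(** For uniqueness, a point common to two cones lies in their common face, whose
    generators are determined by the face and are independent. *)
Lemma complex_of_braid_complex : braid_complex R complex_of.
Proof.
have [[_ _ faces inter] _] := smS.
split.
- by move=> S A /complex_ofP[_ pS _]; apply: pS.
- move=> S T /complex_ofP[Ss pS iS] TS; apply/complex_ofP; split.
  + exact: (faces _ _ Ss (pcone_sub_face iS TS)).
  + by move=> A /(fintype.subsetP TS)/pS.
  + exact: (indep_sub TS iS).
- move=> S T lam mu /complex_ofP[Ss pS iS] /complex_ofP[Ts pT iT] lS mT E.
  have [[u u0 Eu] [u' u0' Eu']] := inter _ _ Ss Ts.
  have [ux u'x] : u (comb lam) = 0 /\ u' (comb lam) = 0.
    have H : (pcone S `&` pcone T) (comb lam).
      by split; [exists lam | exists mu].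
    by split; [move: H; rewrite Eu => -[] | move: H; rewrite Eu' => -[]].
  rewrite face_of_pcone // in Eu; rewrite face_of_pcone // in Eu'.
  set S0 := [set A in S | u (vec R A) == 0]%SET in Eu.
  set T0 := [set A in T | u' (vec R A) == 0]%SET in Eu'.
  have S0S : S0 \subset S by apply/fintype.subsetP => A; rewrite inE => /andP[].
  have T0T : T0 \subset T by apply/fintype.subsetP => A; rewrite inE => /andP[].
  have pS0 A : A \in S0 -> nontrivial A by move=> /(fintype.subsetP S0S)/pS.
  have pT0 A : A \in T0 -> nontrivial A by move=> /(fintype.subsetP T0T)/pT.
  have iS0 := indep_sub S0S iS; have iT0 := indep_sub T0T iT.
  have gE : [set lat A | A in [set` S0]] = [set lat A | A in [set` T0]].
    rewrite -!(@gens_pcone R) -?Eu -?Eu' //.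
    - by move=> A; apply: (indep_exposed iT0).
    - by move=> A; apply: (indep_exposed iS0).
  have T0S0 A : A \in T0 -> A \in S0.
    move=> AT; have : [set lat A | A in [set` T0]] (lat A) by exists A.
    by rewrite -gE => -[B /= BS /lat_inj <- //]; [exact: pS0|exact: pT0].
  apply: (indep_inj iS0 _ _ E) => A.
    rewrite inE negb_and => /orP[/lS.2 //|]; apply: (nonneg_on_pcone0 lS) => //.
    by move=> B BS; apply/u0/pcone_vec.
  move=> AS0; have : A \notin T0 by apply: contraNN AS0; apply: T0S0.
  rewrite inE negb_and => /orP[/mT.2 //|]; apply: (nonneg_on_pcone0 mT) => //.
    by move=> B BT; apply/u0'/pcone_vec.
  by rewrite -E.
- move=> w; have [sigma Ss ws] := chamber_in_fan w.
  have [S [E pS iS]] := fan_cone_simplicial Ss.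
  by exists S; [apply/complex_ofP; split; rewrite -?E | rewrite -E].
Qed.
End Fan.
End SmoothFans.

Theorem theorem3p2 (R : realType) (n : nat) (Sigma : set (set (spaceN R n))) :
  smooth_fan Sigma -> complete Sigma -> refined_by Sigma (braid_fan R n) ->
  exists (l : nat) (Sigmas : nat -> set (set (spaceN R n))),
    [/\ Sigmas 0%N = Sigma,
        Sigmas l = braid_fan R n,
        forall i : nat, (i <= l)%N -> is_fan (Sigmas i)
      & forall i : nat, (1 <= i <= l)%N ->
          obtained_by_star_subdivision (Sigmas i.-1) (Sigmas i)].
Proof.
move=> smS _ refS.
have := subdivide_to_braid_fan (complex_of_braid_complex smS refS).
by rewrite fan_of_complex_of.
Qed.
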